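(* Let $K$ be a field. For all integers $d$ and $r$ with $d \geq 4$ and $1 \leq r \leq d+1$, there exists a reflexive polytope $P \subset \mathbb{R}^d$ of dimension $d$ such that $\operatorname{depth} K[P] = r$ and the dual polytope $P^\vee$ is normal.
   Context: A lattice polytope is a convex polytope $P \subset \mathbb{R}^d$ each of whose vertices belongs to $\mathbb{Z}^d$. A lattice polytope $P \subset \mathbb{R}^d$ of dimension $d$ is reflexive if the origin of $\mathbb{R}^d$ belongs to the interior of $P$ and the dual polytope $P^\vee = \{\mathbf{x} \in \mathbb{R}^d : \langle \mathbf{x}, \mathbf{y}\rangle \leq 1 \text{ for all } \mathbf{y} \in P\}$ is a lattice polytope, where $\langle\cdot,\cdot\rangle$ is the canonical inner product. A lattice polytope $P \subset \mathbb{R}^d$ is normal if for each integer $N \geq 1$ and each $\mathbf{a} \in NP \cap \mathbb{Z}^d$ there exist $\mathbf{a}_1, \ldots, \mathbf{a}_N \in P \cap \mathbb{Z}^d$ with $\mathbf{a} = \mathbf{a}_1 + \cdots + \mathbf{a}_N$, where $NP = \{N\mathbf{a} : \mathbf{a} \in P\}$. The toric ring $K[P]$ of a lattice polytope $P \subset \mathbb{R}^d$ is the $K$-subalgebra of $K[t_1, \ldots, t_d, t_1^{-1}, \ldots, t_d^{-1}, s]$ generated by the monomials $t_1^{a_1}\cdots t_d^{a_d}s$ with $(a_1, \ldots, a_d) \in P \cap \mathbb{Z}^d$; it is graded by the degree in $s$, and $\operatorname{depth} K[P]$ denotes its depth (with respect to the graded maximal ideal, generated by these monomials). *)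

(* Defs.v *)
From HB Require Import structures.
From mathcomp Require Import all_boot all_order all_algebra finmap.
From mathcomp Require Import all_classical all_reals all_analysis.
(* [-(notations)]: the notations of [monalg] cannot be loaded together with
   those of MathComp-Analysis. *)
From mathcomp Require Import -(notations) monalg.

Set Implicit Arguments.
Unset Strict Implicit.
Unset Printing Implicit Defensive.

Import Order.TTheory GRing.Theory Num.Theory.
Import numFieldNormedType.Exports.

Local Open Scope classical_set_scope.
Local Open Scope ring_scope.

Section Polytopes.
Context {R : realType} {d : nat}.
Implicit Types (P : set 'rV[R]_d) (x y v : 'rV[R]_d).

Definition conv_hull (S : set 'rV[R]_d) : set 'rV[R]_d :=
  smallest (@convex_set R 'rV[R]_d) S.

Definition polytope P := exists s : seq 'rV[R]_d, P = conv_hull [set` s].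

Definition vertex P v :=
  P v /\ forall x y (t : R), P x -> P y -> 0 < t < 1 ->
           v = t *: x + (1 - t) *: y -> x = v /\ y = v.

Definition toR (a : 'rV[int]_d) : 'rV[R]_d := map_mx intr a.

Definition lattice_polytope P :=
  polytope P /\ forall v, vertex P v -> exists a, v = toR a.

(* The dimension is that of the affine hull: [U] below is the direction space
   of the affine hull of [P]. *)
Definition has_dim P (k : nat) :=
  P !=set0 /\
  exists U : {vspace 'rV[R]_d},
    [/\ \dim U = k,
        forall x y, P x -> P y -> x - y \in U &
        forall V : {vspace 'rV[R]_d},
          (forall x y, P x -> P y -> x - y \in V) -> (U <= V)%VS].

Definition inner x y : R := \sum_(i < d) x 0 i * y 0 i.

Definition dual P : set 'rV[R]_d := [set x | forall y, P y -> inner x y <= 1].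

Definition reflexive_polytope P :=
  [/\ lattice_polytope P, has_dim P d, P° 0 & lattice_polytope (dual P)].

Definition dilate (N : nat) P : set 'rV[R]_d := [set N%:R *: x | x in P].

Definition normal_polytope P :=
  lattice_polytope P /\
  forall (N : nat) (a : 'rV[int]_d), (1 <= N)%N -> dilate N P (toR a) ->
    exists b : 'I_N -> 'rV[int]_d,
      (forall i, P (toR (b i))) /\ a = \sum_(i < N) b i.

End Polytopes.

(* [monalg] has the module of finitely supported functions, but its ring
   structure requires a monoid without nontrivial units, which excludes Z^d. *)
Definition monoid_alg (k : comNzRingType) (M : nmodType) : Type :=
  @malg M k.

Section MonoidAlgebra.
Context (k : comNzRingType) (M : nmodType).

HB.instance Definition _ := GRing.Lmodule.on (monoid_alg k M).

Implicit Types (f g h : monoid_alg k M) (m n : M).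

(* [term c m] is c X^m. *)
Definition term (c : k) m : monoid_alg k M := mkmalgU m c.

Definition ma_one : monoid_alg k M := term 1 0.

Definition ma_mul f g : monoid_alg k M :=
  \sum_(m <- msupp f) \sum_(n <- msupp g)
    term (mcoeff m f * mcoeff n g) (m + n).

Lemma ma_mulw (d1 d2 : {fset M}) f g :
  fsubset (msupp f) d1 -> fsubset (msupp g) d2 ->
  ma_mul f g = \sum_(m <- d1) \sum_(n <- d2)
                 term (mcoeff m f * mcoeff n g) (m + n).
Proof.
move=> le1 le2; rewrite /ma_mul (big_fset_incl _ le1) /=; last first.
  move=> m _ /mcoeff_outdom fm; rewrite big1 // => n _.
  by rewrite fm mul0r; exact: monalgU0.
apply: eq_bigr => m _; apply: big_fset_incl => // n _ /mcoeff_outdom ->.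
by rewrite mulr0; exact: monalgU0.
Qed.

Lemma ma_mulC : commutative ma_mul.
Proof.
move=> f g; rewrite /ma_mul exchange_big /=; apply: eq_bigr => n _.
by apply: eq_bigr => m _; rewrite mulrC addrC.
Qed.

Lemma ma_mulDl : left_distributive ma_mul +%R.
Proof.
move=> f1 f2 g.
rewrite [in RHS](ma_mulw (fsubsetUl _ (msupp f2)) (fsubset_refl _)).
rewrite [in RHS](ma_mulw (fsubsetUr (msupp f1) _) (fsubset_refl _)).
rewrite (ma_mulw (msuppD_le _ _) (fsubset_refl _)).
rewrite -big_split /=; apply: eq_bigr => m _.
rewrite -big_split /=; apply: eq_bigr => n _.
by rewrite mcoeffD mulrDl; exact: monalgUD.
Qed.

Lemma ma_mul0 : left_zero 0 ma_mul.
Proof. by move=> g; rewrite /ma_mul msupp0 big_seq_fset0. Qed.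

Lemma ma_mul_suml I (s : seq I) (F : I -> monoid_alg k M) g :
  ma_mul (\sum_(i <- s) F i) g = \sum_(i <- s) ma_mul (F i) g.
Proof.
exact: (big_morph (ma_mul^~ g) (fun _ _ => ma_mulDl _ _ _) (ma_mul0 _)).
Qed.

Lemma ma_mul_sumr I (s : seq I) (F : I -> monoid_alg k M) g :
  ma_mul g (\sum_(i <- s) F i) = \sum_(i <- s) ma_mul g (F i).
Proof. by rewrite ma_mulC ma_mul_suml; apply: eq_bigr => i _; exact: ma_mulC. Qed.

Lemma ma_mul_term c1 c2 m1 m2 :
  ma_mul (term c1 m1) (term c2 m2) = term (c1 * c2) (m1 + m2).
Proof. by rewrite (ma_mulw msuppU_le msuppU_le) !big_seq_fset1 !mcoeffUU. Qed.

Lemma ma_termE f : f = \sum_(m <- msupp f) term (mcoeff m f) m.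
Proof. exact: monalgE. Qed.

Lemma ma_mul1 : left_id ma_one ma_mul.
Proof.
move=> f; rewrite {1}[f]ma_termE ma_mul_sumr [RHS]ma_termE.
by apply: eq_bigr => m _; rewrite ma_mul_term mul1r add0r.
Qed.

Lemma ma_mulA : associative ma_mul.
Proof.
move=> f g h; rewrite [f]ma_termE !ma_mul_suml; apply: eq_bigr => m1 _.
rewrite [g]ma_termE ma_mul_sumr !ma_mul_suml ma_mul_sumr.
apply: eq_bigr => m2 _; rewrite ma_mul_term.
rewrite [h]ma_termE !ma_mul_sumr; apply: eq_bigr => m3 _.
by rewrite !ma_mul_term mulrA addrA.
Qed.

Lemma ma_one_neq0 : ma_one != 0.
Proof. by rewrite /ma_one /term monalgU_eq0 oner_eq0. Qed.

HB.instance Definition _ := GRing.Zmodule_isComNzRing.Build (monoid_alg k M)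
  ma_mulA ma_mulC ma_mul1 ma_mulDl ma_one_neq0.

Lemma ma_scaleE c f : c *: f = term c 0 * f.
Proof.
rewrite [f]ma_termE mulr_sumr scaler_sumr; apply: eq_bigr => m _.
rewrite [RHS]ma_mul_term add0r; apply/malgP => n.
by rewrite mcoeffZ !mcoeffU mulrnAr.
Qed.

Lemma ma_scaleAl c f g : c *: (f * g) = (c *: f) * g.
Proof. by rewrite !ma_scaleE mulrA. Qed.

HB.instance Definition _ :=
  GRing.Lmodule_isLalgebra.Build k (monoid_alg k M) ma_scaleAl.
HB.instance Definition _ :=
  GRing.Lalgebra_isComAlgebra.Build k (monoid_alg k M).

End MonoidAlgebra.

Section GeneratedSubalgebra.
Context (k : comNzRingType) (A : comAlgType k) (S : set A).

Definition subalg_gen : {pred A} :=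
  fun x => `[< forall B : {pred A},
                 GRing.subalg_closed B -> (forall y, S y -> y \in B) ->
                 x \in B >].

Lemma subalg_gen_closed : GRing.subalg_closed subalg_gen.
Proof.
split=> [|c x y /asboolP xS /asboolP yS|x y /asboolP xS /asboolP yS];
  apply/asboolP => B clB SB; have [B1 BZ BM] := clB.
- exact: B1.
- exact: BZ (xS B clB SB) (yS B clB SB).
- exact: BM (xS B clB SB) (yS B clB SB).
Qed.

HB.instance Definition _ :=
  GRing.isSubalgClosed.Build k A subalg_gen
    (GRing.subalg_closed_semi subalg_gen_closed).

Record subalg := Subalg { subalg_val : A; _ : subalg_val \in subalg_gen }.

HB.instance Definition _ := [isSub for subalg_val].
HB.instance Definition _ := [Choice of subalg by <:].
HB.instance Definition _ := [SubChoice_isSubComNzRing of subalg by <:].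
HB.instance Definition _ := [SubZmodule_isSubLmodule of subalg by <:].
HB.instance Definition _ := [SubNzRing_SubLmodule_isSubLalgebra of subalg by <:].
HB.instance Definition _ := [SubLalgebra_isSubAlgebra of subalg by <:].

End GeneratedSubalgebra.

Section Depth.
Context {A : comNzRingType}.
Implicit Types (S I : set A) (xs : seq A).

Definition ideal_gen S : set A :=
  [set x | exists (n : nat) (c g : 'I_n -> A),
     (forall i, S (g i)) /\ x = \sum_(i < n) c i * g i].

(* [xs] is an A-regular sequence: [xs`_i] is a nonzerodivisor modulo the ideal
   generated by its predecessors, and [xs] does not generate the unit ideal. *)
Definition regular_sequence xs :=
  (forall i, (i < size xs)%N -> forall y,
     ideal_gen [set` take i xs] (xs`_i * y) -> ideal_gen [set` take i xs] y) /\
  ~ ideal_gen [set` xs] 1.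

(* The depth of [A] with respect to [I]: the maximal length of an A-regular
   sequence in [I]. *)
Definition has_depth I (r : nat) :=
  (exists xs, [/\ regular_sequence xs, [set` xs] `<=` I & size xs = r]) /\
  forall xs, regular_sequence xs -> [set` xs] `<=` I -> (size xs <= r)%N.

End Depth.

(* K[t_1, ..., t_d, t_1^-1, ..., t_d^-1, s] is the algebra of the monoid
   Z^d x N: the exponent [(a, n)] stands for t_1^a_1 ... t_d^a_d s^n. *)
Definition laurent_ring (K : fieldType) (d : nat) : comAlgType K :=
  monoid_alg K ('rV[int]_d * nat)%type.

Definition laurent_monomial (K : fieldType) (d : nat)
    (a : 'rV[int]_d) (n : nat) : laurent_ring K d :=
  term 1 (a, n).

Section ToricRing.
Context (K : fieldType) {R : realType} {d : nat} (P : set 'rV[R]_d).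

Definition toric_generator (f : laurent_ring K d) :=
  exists a : 'rV[int]_d, P (toR a) /\ f = laurent_monomial K a 1.

Definition toric_ring := subalg toric_generator.

Definition toric_max_ideal : set toric_ring :=
  ideal_gen [set f | toric_generator (val f)].

Definition depth_toric_ring (r : nat) := has_depth toric_max_ideal r.

End ToricRing.

(* Main.v *)
(* A polytope is given by the list V of its lattice points. K[P] is spanned by
   the monomials (a, n) with a a sum of n points of V. If y_1, ..., y_r in V
   are such that x + y_i and x + y_j (i <> j) can only both lie in this monoid
   when x does, then their monomials form a regular sequence; if moreover some
   monomial is a socle element modulo them, the depth is r, by the grade
   inequality for Koszul cohomology.

   If every lattice point of a dilate of the dual Q of P is a sum of lattice
   points of Q, then Q is the hull of its lattice points: approximate a point
   of Q by lattice points of large dilates. So P is reflexive and Q normal.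

   A skew bipyramid, K[V] to K[V][p, q]/(pq - y^2), raises both the dimension
   and the depth by 1; a prism raises the dimension and keeps depth 1. It
   remains to treat the point and four polytopes of dimension 4, of depths 1,
   2, 3 and 4. *)

Require Import Defs.
From mathcomp Require Import all_boot all_order all_algebra finmap.
From mathcomp Require Import all_classical all_reals all_analysis.
From mathcomp Require Import -(notations) monalg.
From mathcomp Require Import zify ring lra.

Set Implicit Arguments.
Unset Strict Implicit.
Unset Printing Implicit Defensive.

Import Order.TTheory GRing.Theory Num.Theory.
Import numFieldNormedType.Exports.

Local Open Scope classical_set_scope.
Local Open Scope ring_scope.

(** * Grade *)

(** If P were normal, K[P] would be Cohen-Macaulay, of depth d + 1. A smaller depth must come from
    holes, lattice points of dilates of P that are not sums of lattice points of P, while the dual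
    may have none. Both requirements are therefore expressed over the integers: membership in the
    monoid by explicit inequalities, and normality of the dual by the existence of one summand to
    split off. Vertices and facets of P or of its dual are never computed, and real geometry enters
    through one limit argument.

    The choice of base cases comes from d - r. A bipyramid leaves it unchanged, the point has d - r
    = -1, and the polytopes of dimension 4 realise the values 0, 1, 2 and 3. Larger values need
    prisms, which increase d - r by one but only at depth 1; so the prisms are taken first and the
    bipyramids afterwards. *)

Section Ideals.
Context {A : comNzRingType}.
Implicit Types (S : set A) (xs zs : seq A) (x y z : A).

Lemma ideal_genS S1 S2 : S1 `<=` S2 -> ideal_gen S1 `<=` ideal_gen S2.
Proof.
by move=> S12 x [n [c [g [Sg ->]]]]; exists n, c, g; split=> // i; exact/S12/Sg.
Qed.

Lemma ideal_gen_incl S x : S x -> ideal_gen S x.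
Proof.
move=> Sx; exists 1%N, (fun=> 1), (fun=> x); split=> //.
by rewrite big_ord1 mul1r.
Qed.

Lemma ideal_gen0 S : ideal_gen S 0.
Proof.
by exists 0%N, (fun=> 0), (fun=> 0); split; [case | rewrite big_ord0].
Qed.

Lemma ideal_genD S x y : ideal_gen S x -> ideal_gen S y -> ideal_gen S (x + y).
Proof.
move=> [n [c [g [Sg ->]]]] [m [c' [g' [Sg' ->]]]].
exists (n + m)%N,
  (fun i => match fintype.split i with inl j => c j | inr j => c' j end),
  (fun i => match fintype.split i with inl j => g j | inr j => g' j end).
split=> [i|]; first by case: (fintype.split i).
rewrite big_split_ord /=; congr (_ + _); apply: eq_bigr => i _.
- by rewrite (unsplitK (inl i)).
- by rewrite (unsplitK (inr i)).
Qed.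

Lemma ideal_genM S a x : ideal_gen S x -> ideal_gen S (a * x).
Proof.
move=> [n [c [g [Sg ->]]]]; exists n, (fun i => a * c i), g; split=> //.
by rewrite mulr_sumr; apply: eq_bigr => i _; rewrite mulrA.
Qed.

Lemma ideal_genN S x : ideal_gen S x -> ideal_gen S (- x).
Proof. by rewrite -mulN1r; exact: ideal_genM. Qed.

Lemma ideal_genB S x y : ideal_gen S x -> ideal_gen S y -> ideal_gen S (x - y).
Proof. by move=> Sx Sy; apply/ideal_genD/ideal_genN. Qed.

Lemma ideal_gen_sum S I (s : seq I) (P : pred I) (F : I -> A) :
  (forall i, P i -> ideal_gen S (F i)) -> ideal_gen S (\sum_(i <- s | P i) F i).
Proof.
move=> SF; elim/big_ind: _ => //; [exact: ideal_gen0 | exact: ideal_genD].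
Qed.

Lemma ideal_gen_rcons xs x y :
  ideal_gen [set` rcons xs x] y <-> exists a, ideal_gen [set` xs] (y - a * x).
Proof.
split=> [[n [c [g [Sg ->]]]]|[a ya]].
  elim: n c g Sg => [|n IHn] c g Sg.
    by exists 0; rewrite big_ord0 mul0r subr0; exact: ideal_gen0.
  rewrite big_ord_recl.
  have [a IHa] := IHn (fun i => c (lift ord0 i)) (fun i => g (lift ord0 i))
                      (fun i => Sg _).
  have := Sg ord0; rewrite /mkset /= mem_rcons inE => /orP[/eqP ->|g0].
    by exists (c ord0 + a); rewrite mulrDl opprD addrACA subrr add0r.
  exists a; rewrite -addrA; apply: ideal_genD => //.
  by apply/ideal_genM/ideal_gen_incl.
have -> : y = (y - a * x) + a * x by rewrite subrK.
apply: ideal_genD.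
  by apply: ideal_genS ya => z /=; rewrite mem_rcons inE => ->; rewrite orbT.
by apply/ideal_genM/ideal_gen_incl => /=; rewrite mem_rcons mem_head.
Qed.

End Ideals.

(** * Koszul cohomology and the grade inequality *)

Section Grade.
Context {A : comNzRingType}.
Implicit Types (S : set A) (xs ys zs : seq A) (x y z u : A).
Implicit Types (c e : bitseq -> A) (b : bitseq).

(* The Koszul differential; a cochain is a function on subsets of [zs], encoded
   as masks. *)
Fixpoint koszul zs c b : A :=
  match zs, b with
  | z :: zs', false :: b' => koszul zs' (fun b => c (false :: b)) b'
  | z :: zs', true :: b' =>
      z * c (false :: b') - koszul zs' (fun b => c (true :: b)) b'
  | _, _ => 0
  end.

Lemma koszulZ zs z c b : koszul zs (fun b => z * c b) b = z * koszul zs c b.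
Proof.
elim: zs c b => [|z' zs IH] c [|[] b] /=; rewrite ?mulr0 //.
by rewrite (IH (fun b => c (true :: b))); ring.
Qed.

Lemma koszulB zs c e b :
  koszul zs (fun b => c b - e b) b = koszul zs c b - koszul zs e b.
Proof.
elim: zs c e b => [|z zs IH] c e [|[] b] /=; rewrite ?subr0 //.
by rewrite (IH (fun b => c (true :: b)) (fun b => e (true :: b))); ring.
Qed.

Lemma koszulK zs c b : koszul zs (koszul zs c) b = 0.
Proof.
elim: zs c b => [|z zs IH] c [|[] b] //=.
rewrite (koszulB _ (fun b => z * c (false :: b))) koszulZ.
by rewrite (IH (fun b => c (true :: b))) subr0 subrr.
Qed.

(* [koszul zs c b] only involves the values of [c] at masks of size [size b]
   with one bit less than [b]. *)
Lemma koszul_ideal S zs c b :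
  (forall b', size b' = size b -> count id b = (count id b').+1 ->
    ideal_gen S (c b')) ->
  ideal_gen S (koszul zs c b).
Proof.
elim: zs c b => [|z zs IH] c [|[] b] /= cI; try exact: ideal_gen0.
- apply: ideal_genB; first by apply/ideal_genM/cI.
  by apply: IH => b' sb' cb'; apply: cI => /=; rewrite ?sb' ?cb'.
- by apply: IH => b' sb' cb'; apply: cI; rewrite /= ?sb' ?cb'.
Qed.

Lemma koszul_count0 zs c b : count id b = 0%N -> koszul zs c b = 0.
Proof. by elim: zs c b => [|z zs IH] c [|[] b] //= /IH. Qed.

(* H^i(zs; A / ideal_gen S) = 0 for all i < k. *)
Definition koszul_exact zs S k := forall i c, (i < k)%N ->
  (forall b, size b = size zs -> count id b = i.+1 ->
     ideal_gen S (koszul zs c b)) ->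
  exists e, forall b, size b = size zs -> count id b = i ->
     ideal_gen S (c b - koszul zs e b).

Definition nonzerodivisor_mod S x :=
  forall y, ideal_gen S (x * y) -> ideal_gen S y.

Lemma ideal_gen_rcons_fun xs x (P : bitseq -> Prop) (f : bitseq -> A) :
  (forall b, P b -> ideal_gen [set` rcons xs x] (f b)) ->
  exists g : bitseq -> A, forall b, P b -> ideal_gen [set` xs] (f b - x * g b).
Proof.
move=> Pf; suff /choice[g gP] : forall b, exists a,
    P b -> ideal_gen [set` xs] (f b - x * a) by exists g.
move=> b; have [/Pf/ideal_gen_rcons[a fa]|nPb] := pselect (P b).
  by exists a => _; rewrite mulrC.
by exists 0.
Qed.

(** This is the long exact sequence of multiplication by [x] on A / (xs): the connecting map costs
    one degree of vanishing. *)
Lemma koszul_exact_quotient zs xs x k : nonzerodivisor_mod [set` xs] x ->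
  koszul_exact zs [set` xs] k.+1 -> koszul_exact zs [set` rcons xs x] k.
Proof.
move=> xnzd ex i c ik dc.
have [f fE] := ideal_gen_rcons_fun
  (P := fun b => size b = size zs /\ count id b = i.+1)
  (fun b sc => dc b sc.1 sc.2).
have [|b sb cb|e eE] := ex i.+1 f; first by rewrite ltnS.
  (* Modulo xs, x f is the differential of c, so x kills the differential of f; hence f is a
     cocycle. *)
  apply: xnzd.
  rewrite -koszulZ -[koszul _ _ _]subr0 -(koszulK zs c b) -koszulB.
  apply: koszul_ideal => b' sb' cb'; rewrite -opprB; apply/ideal_genN/fE.
  by split; [rewrite sb' | apply: succn_inj; rewrite -cb'].
have [|b sb cb|g gE] := ex i (fun b => c b - x * e b); first exact: ltnW.
  rewrite koszulB koszulZ -(subrKA (x * f b)) -mulrBr.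
  by apply: ideal_genD; [exact: fE | apply/ideal_genM/eE].
exists g => b sb cb; apply/ideal_gen_rcons; exists (e b).
by rewrite addrAC [e b * x]mulrC; exact: gE.
Qed.

(** The complex of [z :: zs] is the mapping cone of [z] on that of [zs]. Since [z] is injective on A
    / (xs), the cone computes the cohomology of [zs] on the quotient by [z], shifted by one
    degree. *)
Lemma koszul_exact_cons z zs xs k : nonzerodivisor_mod [set` xs] z ->
  koszul_exact zs [set` rcons xs z] k -> koszul_exact (z :: zs) [set` xs] k.+1.
Proof.
move=> znzd ex [|i] c ik dc.
  exists (fun=> 0) => -[|[] b] //= [sb]; rewrite add0n => cb.
  rewrite koszul_count0 // subr0; apply: znzd.
  have /= := dc (true :: b); rewrite sb add1n cb koszul_count0 // subr0.
  exact.
pose c0 b := c (false :: b); pose c1 b := c (true :: b).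
have dc1 b : size b = size zs -> count id b = i.+1 ->
    ideal_gen [set` xs] (koszul zs c1 b - z * c0 b).
  move=> sb cb; rewrite -opprB; apply: ideal_genN.
  by apply: (dc (true :: b)); rewrite /= ?sb // add1n cb.
have [|b sb cb|g gE] := ex i c1; first by [].
  by apply/ideal_gen_rcons; exists (c0 b); rewrite mulrC; exact: dc1.
have [h hE] := ideal_gen_rcons_fun
  (P := fun b => size b = size zs /\ count id b = i)
  (fun b sc => gE b sc.1 sc.2).
(* The cone differential sends (h, e1) to dh and z h - d e1, so writing c1 as dg + z h forces e1 =
   -g. *)
exists (fun b => if b is a :: b' then if a then - g b' else h b' else 0).
case=> [|[] b] //= [sb] cb.
  have -> : koszul zs (fun b => - g b) b = - koszul zs g b.
    by rewrite -mulN1r -koszulZ; congr koszul; apply/funext => b'; rewrite mulN1r.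
  have -> : c (true :: b) - (z * h b - - koszul zs g b) =
    c1 b - koszul zs g b - z * h b by rewrite /c1; ring.
  by apply: hE; split=> //; apply: succn_inj; rewrite -cb add1n.
apply: znzd; rewrite mulrBr -koszulZ.
have -> : z * c (false :: b) - koszul zs (fun b => z * h b) b =
  - (koszul zs c1 b - z * c0 b) + koszul zs (fun b => (c1 b - koszul zs g b) - z * h b) b.
  rewrite koszulB (koszulB _ c1) koszulK /c0; ring.
apply: ideal_genD; first by apply/ideal_genN/dc1.
apply: koszul_ideal => b' sb' cb'; apply: hE.
by split; [rewrite sb' | apply: succn_inj; rewrite -cb'].
Qed.

Lemma koszul_cst S zs u b : (forall z, z \in zs -> ideal_gen S (z * u)) ->
  count id b = 1%N -> ideal_gen S (koszul zs (fun=> u) b).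
Proof.
elim: zs b => [|z zs IH] [|[] b] //= zu; try by move=> _; exact: ideal_gen0.
  rewrite add1n => -[cb]; rewrite koszul_count0 // subr0.
  by apply: zu; exact: mem_head.
by apply: IH => y yz; apply: zu; rewrite inE yz orbT.
Qed.

Lemma regular_sequence_nzd xs : regular_sequence xs ->
  forall ys x zs, xs = ys ++ x :: zs -> nonzerodivisor_mod [set` ys] x.
Proof.
move=> [reg _] ys x zs xsE y; have := reg (size ys); rewrite xsE.
rewrite size_cat /= -addSnnS leq_addr take_size_cat // nth_cat ltnn subnn /=.
exact.
Qed.

(* The grade inequality: an ideal with a regular sequence [zs] annihilates no
   nonzero class modulo a shorter regular sequence [xs]. *)
Lemma regular_sequence_colon zs xs u :
  regular_sequence zs -> regular_sequence xs -> (size xs < size zs)%N ->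
  (forall z, z \in zs -> ideal_gen [set` xs] (z * u)) -> ideal_gen [set` xs] u.
Proof.
move=> regz regx ltxz zu.
have exz ys zs' : ys ++ zs' = zs -> koszul_exact zs' [set` ys] (size zs').
  elim: zs' ys => [|z zs' IH] ys zsE; first by [].
  apply: koszul_exact_cons; first exact: (regular_sequence_nzd regz (esym zsE)).
  by apply: IH; rewrite cat_rcons.
(* Each element of xs costs one degree. As xs is shorter than zs, degree 0 survives, and there
   exactness says that an element killed by zs vanishes. *)
have exx ys xs' : ys ++ xs' = xs ->
    koszul_exact zs [set` ys] (size zs - size ys)%N.
  elim/last_ind: ys xs' => [|ys x IH] xs' xsE.
    by rewrite subn0; exact: (exz [::] zs erefl).
  apply: koszul_exact_quotient.
    by apply: (regular_sequence_nzd regx (zs := xs')); rewrite -cat_rcons.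
  rewrite size_rcons subnSK; first by apply: (IH (x :: xs')); rewrite -cat_rcons.
  by apply: leq_ltn_trans ltxz; rewrite -xsE size_cat size_rcons addSn ltnW // ltnS leq_addr.
have [||e eE] := exx xs [::] (cats0 _) 0%N (fun=> u).
- by rewrite subn_gt0.
- by move=> b sb; exact: koszul_cst.
have := eE (nseq (size zs) false); rewrite size_nseq koszul_count0.
  by rewrite subr0; apply=> //; elim: (size zs).
by elim: (size zs).
Qed.

End Grade.

(** * Depth of toric rings *)

Section Combinatorics.
Context {d : nat}.
Implicit Types (V ys : seq 'rV[int]_d) (a b v w y : 'rV[int]_d).

Fixpoint nsum V n a : Prop :=
  if n is m.+1 then exists2 v, v \in V & nsum V m (a - v) else a = 0.

Lemma nsumD V n m a b : nsum V n a -> nsum V m b -> nsum V (n + m) (a + b).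
Proof.
elim: n a => [|n IH] a /=; first by move=> ->; rewrite add0r.
by move=> [v vV av] bm; exists v => //; rewrite addrAC; exact: IH.
Qed.

Lemma nsum1 V v : v \in V -> nsum V 1 v.
Proof. by move=> vV; exists v => //=; rewrite subrr. Qed.

(* (a, n) lies in the ideal of the monoid generated by the (y, 1), y in ys. *)
Definition in_translates V ys n a : Prop :=
  if n is m.+1 then exists2 y, y \in ys & nsum V m (a - y) else False.

(* By [cert_reg] the monomials of [ys] form a regular sequence, and the last
   three fields make (a, n) a socle element modulo that sequence. *)
Record depth_certificate V ys n a : Prop := DepthCertificate {
  cert_sub : {subset ys <= V};
  cert_uniq : uniq ys;
  cert_reg : forall y y', y \in ys -> y' \in ys -> y != y' ->
    forall m b, nsum V m.+1 (b + y) -> nsum V m.+1 (b + y') -> nsum V m b;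
  cert_mem : nsum V n a;
  cert_notin : ~ in_translates V ys n a;
  cert_socle : forall v, v \in V -> in_translates V ys n.+1 (a + v) }.

End Combinatorics.

(** * Monomial ideals of the toric ring *)

Section ToricAlgebra.
Context (K : fieldType) {R : realType} {d : nat} (P : set 'rV[R]_d).
Context (V : seq 'rV[int]_d) (PV : forall a, P (toR a) <-> a \in V).
Local Notation L := (laurent_ring K d).
Local Notation A := (toric_ring K P).
Local Notation gens := (@toric_generator K R d P).
Implicit Types (f g : L) (a v y : 'rV[int]_d) (ys : seq 'rV[int]_d) (m k : 'rV[int]_d * nat).

Lemma mcoeff_mul_term c k f m : mcoeff (m + k) (term c k * f : L) = c * mcoeff m f.
Proof.
rewrite [f]ma_termE mulr_sumr !raddf_sum mulr_sumr; apply: eq_bigr => n _ /=.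
rewrite [term c k * _]ma_mul_term !mcoeffU [k + n]addrC mulrnAr.
congr (_ *+ _); rewrite -[in RHS]pair_eqE -pair_eqE /=.
by rewrite (inj_eq (addIr _)) eqn_add2r.
Qed.

Lemma pairD1 m a : m + (a, 1%N) = (m.1 + a, m.2.+1).
Proof. by case: m => b n; apply/pair_equal_spec; split; last exact: addn1. Qed.

Lemma mcoeff_scale c f m : mcoeff m (c *: f : L) = c * mcoeff m f.
Proof. by rewrite ma_scaleE -[m in LHS]addr0 mcoeff_mul_term. Qed.

Lemma mcoeff_term_neq0 (c : K) k m : mcoeff m (term c k) != 0 -> m = k.
Proof. by rewrite mcoeffU; have [->|_] := eqVneq k m; rewrite //= mulr0n eqxx. Qed.

Lemma mcoeff_mulP f g m : mcoeff m (f * g : L) != 0 ->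
  exists m1 m2, [/\ m = m1 + m2, mcoeff m1 f != 0 & mcoeff m2 g != 0].
Proof.
rewrite -[f * g]/(ma_mul f g) /ma_mul raddf_sum => /eqP mfg.
have [m1 m1f] : exists2 m1, m1 \in msupp f & mcoeff m (\sum_(n <- msupp g)
    term (mcoeff m1 f * mcoeff n g) (m1 + n)) != 0.
  apply: contrapT => nex; apply: mfg; rewrite big_seq big1 // => m1 m1f.
  by apply/eqP; apply: contraT => m1P; case: nex; exists m1.
rewrite raddf_sum => /eqP mg.
have [m2 m2g] : exists2 m2, m2 \in msupp g &
    mcoeff m (term (mcoeff m1 f * mcoeff m2 g) (m1 + m2)) != 0.
  apply: contrapT => nex; apply: mg; rewrite big_seq big1 // => m2 m2g.
  by apply/eqP; apply: contraT => m2P; case: nex; exists m2.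
by move=> /mcoeff_term_neq0 ->; exists m1, m2; split=> //; rewrite mcoeff_neq0.
Qed.

Lemma subalg_gen_term c n a : nsum V n a -> (term c (a, n) : L) \in subalg_gen gens.
Proof.
move=> an; have -> : (term c (a, n) : L) = c *: (term 1 (a, n) : L).
  by rewrite ma_scaleE [RHS]ma_mul_term add0r mulr1.
apply: rpredZ; elim: n a an => [|n IH] a.
  by move=> ->; exact: rpred1.
move=> [v vV /IH].
have -> : (term 1 (a, n.+1) : L) = term 1 (v, 1%N) * term 1 (a - v, n).
  rewrite [RHS]ma_mul_term mulr1; congr (term 1 _).
  by apply/pair_equal_spec; split; rewrite /= ?add1n // addrC subrK.
move=> avn; apply: rpredM avn; apply/asboolP => B _; apply.
by exists v; split; first exact/PV.
Qed.

Lemma subalg_genP f :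
  f \in subalg_gen gens <-> forall m, mcoeff m f != 0 -> nsum V m.2 m.1.
Proof.
split=> [/asboolP fS|fV].
  pose B : {pred L} := fun f => `[< forall m, mcoeff m f != 0 -> nsum V m.2 m.1 >].
  suff /asboolP : f \in B by [].
  apply: fS => [|_ [v [/PV vV ->]]]; last first.
    by apply/asboolP => m /mcoeff_term_neq0 ->; exact: nsum1.
  split=> [|c x y /asboolP xB /asboolP yB|x y /asboolP xB /asboolP yB];
    apply/asboolP => m.
  - by move/mcoeff_term_neq0 ->.
  - rewrite mcoeffD mcoeff_scale => mxy.
    have [x0|/xB//] := eqVneq (mcoeff m x) 0.
    by apply: yB; move: mxy; rewrite x0 mulr0 add0r.
  - move=> /mcoeff_mulP[m1 [m2 [-> /xB m1x /yB m2y]]]; exact: nsumD.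
rewrite [f]ma_termE big_seq; apply: rpred_sum => -[a n] afn.
by apply: subalg_gen_term; apply: (fV (a, n)); rewrite mcoeff_neq0.
Qed.

(* [monomial c a n] is 0 when [a] is not a sum of [n] points of [V]. *)
Fact monomial_key : unit. Proof. exact: tt. Qed.
Definition monomial : K -> 'rV[int]_d -> nat -> A :=
  locked_with monomial_key (fun c a n => insubd (0 : A) (term c (a, n) : L)).

Lemma val_monomial c a n : nsum V n a -> val (monomial c a n) = (term c (a, n) : L).
Proof.
by move=> an; rewrite /monomial unlock insubdK //; exact: subalg_gen_term.
Qed.

Lemma val_mul (x y : A) : val (x * y) = val x * val y.
Proof. exact: (rmorphM (val : A -> L)). Qed.

Lemma val_sum I (r : seq I) (F : I -> A) :
  val (\sum_(i <- r) F i) = \sum_(i <- r) val (F i).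
Proof. exact: (raddf_sum (val : A -> L)). Qed.

Lemma monomialM c n a y : nsum V n a -> y \in V ->
  monomial c (a + y) n.+1 = monomial c a n * monomial 1 y 1.
Proof.
move=> an yV; apply: val_inj; rewrite [RHS]val_mul !val_monomial //.
- by rewrite [RHS]ma_mul_term mulr1 pairD1.
- exact: nsum1.
- by exists y => //; rewrite addrK.
Qed.

Lemma toric_supp (x : A) m : mcoeff m (val x) != 0 -> nsum V m.2 m.1.
Proof. by apply: (subalg_genP (val x)).1; exact: valP. Qed.

(** The generators are monomials, so membership is tested on each term of the support; this turns
    regularity and the socle condition into statements about the monoid. *)
Lemma ideal_gen_monomialP ys (x : A) : {subset ys <= V} ->
  ideal_gen [set` [seq monomial 1 y 1 | y <- ys]] x <->
  forall m, mcoeff m (val x) != 0 -> in_translates V ys m.2 m.1.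
Proof.
move=> ysV; split=> [[n [c [g [gys ->]]]] m|xys].
  rewrite val_sum raddf_sum => /eqP mcg.
  have [i] : exists i, mcoeff m (val (c i * g i)) != 0.
    apply: contrapT => nex; apply: mcg; apply: big1 => i _.
    by apply/eqP; apply: contraT => iP; case: nex; exists i.
  have /mapP[y yys ->] := gys i.
  rewrite val_mul val_monomial; last exact/nsum1/ysV.
  move=> /mcoeff_mulP[m1 [m2 [-> /toric_supp m1c /mcoeff_term_neq0 ->]]].
  by rewrite pairD1; exists y => //; rewrite addrK.
have -> : x = \sum_(m <- msupp (val x)) monomial (mcoeff m (val x)) m.1 m.2.
  apply: val_inj; rewrite val_sum {1}[val x]ma_termE !big_seq.
  apply: eq_bigr => -[a n] afn; rewrite val_monomial //.
  by apply: (toric_supp (x := x) (m := (a, n))); rewrite mcoeff_neq0.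
rewrite big_seq; apply: ideal_gen_sum => -[a n]; rewrite -mcoeff_neq0 => afn.
have := xys _ afn; case: n afn => //= n afn [y yys ayn].
rewrite -(subrK y a) monomialM //; last exact: ysV.
by apply/ideal_genM/ideal_gen_incl/map_f.
Qed.

Theorem depth_toric_ring_cert ys n u :
  depth_certificate V ys n u -> depth_toric_ring K P (size ys).
Proof.
case=> ysV uniq_ys reg un unot usoc.
pose xs := [seq monomial 1 y 1 | y <- ys].
have regxs : regular_sequence xs.
  split=> [i|]; last first.
    move/(ideal_gen_monomialP _ ysV)/(_ 0); rewrite /= mcoeffU eqxx oner_neq0.
    by apply.
  rewrite size_map => ltiys x; rewrite -map_take.
  have tysV : {subset take i ys <= V} by move=> y /mem_take/ysV.
  rewrite !ideal_gen_monomialP // (nth_map 0) // => xys m mx.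
  have iys : ys`_i \in ys by exact: mem_nth.
  have := xys (m + (ys`_i, 1%N)); rewrite val_mul val_monomial; last exact/nsum1/ysV.
  rewrite mcoeff_mul_term mul1r => /(_ mx).
  rewrite pairD1; case: m mx => a k mx /= [y yt aky].
  have mm := toric_supp mx.
  have yys := mem_take yt.
  have yneq : y != ys`_i.
    by apply: contraTneq yt => ->; rewrite in_take // index_uniq // ltnn.
  (* In degree 0 the only monomial is 1, which would make [y] the i-th point. Otherwise [reg]
     applies to a - y: adding [y] or the i-th point to it gives an element of the monoid. *)
  case: k mx mm aky => [|k] mx mm aky.
    move: mm aky => /= -> /eqP; rewrite add0r subr_eq0 eq_sym => /eqP yE.
    by rewrite yE eqxx in yneq.
  exists y => //; apply: (reg y ys`_i) => //.
  - by rewrite subrK.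
  - by rewrite addrAC.
have xsm : [set` xs] `<=` @toric_max_ideal K R d P.
  move=> x /= /mapP[y yys ->]; apply: ideal_gen_incl => /=.
  rewrite val_monomial; last exact/nsum1/ysV.
  by exists y; split=> //; exact/PV/ysV.
split; first by exists xs; split=> //; rewrite size_map.
move=> zs regzs zsm; rewrite leqNgt; apply/negP => ltzs.
have := regular_sequence_colon regzs regxs _ (u := monomial 1 u n).
rewrite size_map => /(_ ltzs) H.
have /H : forall z, z \in zs -> ideal_gen [set` xs] (z * monomial 1 u n).
  move=> z /zsm[k [c [g [gens_g ->]]]]; rewrite mulr_suml.
  apply: ideal_gen_sum => i _; rewrite -mulrA; apply: ideal_genM.
  apply/ideal_gen_monomialP => // m.
  have [v [/PV vV gE]] := gens_g i.
  rewrite val_mul gE (val_monomial 1 un) [laurent_monomial _ _ _ * _]ma_mul_term.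
  by move=> /mcoeff_term_neq0 ->; rewrite addrC pairD1; exact: usoc.
move=> /(ideal_gen_monomialP _ ysV)/(_ (u, n)); rewrite (val_monomial 1 un) mcoeffUU.
by rewrite oner_neq0 => /(_ isT).
Qed.

End ToricAlgebra.

(** * Reflexive polytopes *)

Section Convexity.
Context {R : realType} {d : nat}.
Implicit Types (C S : set 'rV[R]_d) (s : seq 'rV[R]_d) (x y v w : 'rV[R]_d).

Lemma convex_setP C : convex_set C <->
  forall x y (t : R), C x -> C y -> 0 <= t <= 1 -> C (t *: x + (1 - t) *: y).
Proof.
split=> [cC x y t Cx Cy /andP[t0 t1]|cC x y t /set_mem Cx /set_mem Cy].
  by have := cC x y (Itv01 t0 t1) (mem_set Cx) (mem_set Cy); rewrite inE.
by apply/mem_set/cC => //; rewrite ge0 le1.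
Qed.

Lemma conv_hull_convex S : convex_set (conv_hull S).
Proof.
apply/convex_setP => x y t Sx Sy t01 C [cC SC].
by move/convex_setP : (cC); apply=> //; [apply: Sx | apply: Sy].
Qed.

Lemma sub_conv_hull S : S `<=` conv_hull S.
Proof. exact: sub_gen_smallest. Qed.

Lemma conv_hull_min S C : convex_set C -> S `<=` C -> conv_hull S `<=` C.
Proof. by move=> cC SC; exact: smallest_sub. Qed.

Lemma convex_sum C m (l : 'I_m -> R) (p : 'I_m -> 'rV[R]_d) : convex_set C ->
  (forall i, 0 <= l i) -> \sum_i l i = 1 -> (forall i, C (p i)) ->
  C (\sum_i l i *: p i).
Proof.
move=> /convex_setP cC; elim: m l p => [|m IH] l p l0 l1 Cp.
  by move: l1; rewrite big_ord0 => /eqP; rewrite eq_sym oner_eq0.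
move: l1; rewrite !big_ord_recl => l1.
set t := l ord0 in l1 *; have t0 : 0 <= t := l0 _.
have rest : \sum_(i < m) l (lift ord0 i) = 1 - t by rewrite -l1 addrC addKr.
have t1 : t <= 1 by rewrite -l1 lerDl sumr_ge0.
have [tE|tn1] := eqVneq t 1.
  rewrite big1 => [|i _]; first by rewrite addr0 tE scale1r.
  move: rest; rewrite tE subrr => /eqP; rewrite psumr_eq0 //.
  by move=> /allP/(_ i (mem_index_enum _))/eqP ->; rewrite scale0r.
have t1' : 0 < 1 - t by rewrite subr_gt0 lt_neqAle tn1.
have -> : \sum_(i < m) l (lift ord0 i) *: p (lift ord0 i) =
  (1 - t) *: \sum_(i < m) (l (lift ord0 i) / (1 - t)) *: p (lift ord0 i).
  rewrite scaler_sumr; apply: eq_bigr => i _.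
  by rewrite scalerA mulrC divfK // gt_eqF.
apply: cC; rewrite ?t0 //; apply: IH => // [i|].
  by rewrite divr_ge0 // ltW.
by rewrite -mulr_suml rest divff // gt_eqF.
Qed.

(** As an image of the standard simplex the hull is compact, hence closed. *)
Lemma conv_hull_seqE s : conv_hull [set` s] =
  [set \sum_(i < size s) l 0 i *: s`_i | l in
    [set l : 'rV[R]_(size s) | (forall i, 0 <= l 0 i) /\ \sum_i l 0 i = 1]].
Proof.
apply/seteqP; split=> [|_ [l [l0 l1] <-]]; last first.
  apply: convex_sum => //; first exact: conv_hull_convex.
  by move=> i; apply: sub_conv_hull; exact: mem_nth.
apply: conv_hull_min.
  apply/convex_setP => x y t [l [l0 l1] <-] [m [m0 m1] <-] /andP[t0 t1].
  exists (t *: l + (1 - t) *: m).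
    split=> [i|]; first by rewrite !mxE addr_ge0 // mulr_ge0 // subr_ge0.
    under eq_bigr do rewrite !mxE.
    by rewrite big_split -!mulr_sumr /= l1 m1 !mulr1 addrC subrK.
  rewrite !scaler_sumr -big_split /=; apply: eq_bigr => i _.
  by rewrite !scalerA -scalerDl !mxE.
move=> x /= xs; have ltxs : (index x s < size s)%N by rewrite index_mem.
exists (\row_i (i == Ordinal ltxs)%:R).
  split=> [i|]; first by rewrite mxE ler0n.
  rewrite (bigD1 (Ordinal ltxs)) //= big1 => [|i /negbTE ni]; rewrite mxE ?ni //.
  by rewrite eqxx addr0.
rewrite (bigD1 (Ordinal ltxs)) //= big1 => [|i /negbTE ni].
  by rewrite mxE eqxx scale1r addr0 nth_index.
by rewrite mxE ni scale0r.
Qed.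

Lemma continuous_sum (U : normedModType R) (T : topologicalType) I (r : seq I)
    (F : I -> T -> U) :
  (forall i, continuous (F i)) -> continuous (fun t => \sum_(i <- r) F i t).
Proof.
move=> Fc t; apply: (@cvg_big U I +%R 0 predT) => [|i _]; last exact: Fc.
exact: add_continuous.
Qed.

Lemma conv_hull_closed s : closed (conv_hull [set` s]).
Proof.
apply: compact_closed; first exact: norm_hausdorff.
rewrite conv_hull_seqE; apply: continuous_compact.
  apply: continuous_subspaceT => l.
  apply: (continuous_sum (F := fun i (l : 'rV[R]_(size s)) => l 0 i *: s`_i)).
  by move=> i l'; apply: (@cvgZr_tmp _ _ _ (nbhs l')); exact: coord_continuous.
apply: bounded_closed_compact.
  exists 1; split=> // M M1 l [l0 l1] /=.
  apply: le_trans (ltW M1); rewrite [leLHS]/Num.norm /= mx_normrE.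
  apply: bigmax_le => // -[i j] _ /=; rewrite ord1 ger0_norm //.
  by rewrite -l1 (bigD1 j) //= lerDl sumr_ge0.
rewrite (_ : [set l | _] = \bigcap_(i : 'I_(size s))
  [set l : 'rV[R]_(size s) | 0 <= l 0 i] `&`
  [set l : 'rV[R]_(size s) | \sum_i l 0 i = 1]); last first.
  by apply/seteqP; split=> l [l0 l1]; split=> // i; [move=> _ | ]; exact: l0.
apply: closedI.
  apply: closed_bigI => i _.
  apply: (@closed_comp _ _ (fun l : 'rV[R]_(size s) => l 0 i) [set x | 0 <= x]).
    by move=> l _; exact: coord_continuous.
  exact: closed_ge.
apply: (@closed_comp _ _ (fun l : 'rV[R]_(size s) => \sum_i l 0 i) [set x | x = 1]).
  move=> l _; apply: (continuous_sum (U := R^o)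
    (F := fun i (l : 'rV[R]_(size s)) => l 0 i)).
  by move=> i l'; exact: coord_continuous.
exact: closed_eq.
Qed.

(** Removing an extreme point from a convex set leaves a convex set. If [v] were not in [s], the
    hull without [v] would be a smaller convex set containing [s]. *)
Lemma vertex_conv_hull_seq s v : vertex (conv_hull [set` s]) v -> v \in s.
Proof.
move=> [Pv ext]; apply: contraPT Pv => vs Pv.
suff /(_ v Pv)[] : conv_hull [set` s] `<=` conv_hull [set` s] `\ v.
  by move=> _ /(_ erefl).
apply: conv_hull_min => [|x xs]; last first.
  by split; [exact: sub_conv_hull | move=> xv; rewrite -xv xs in vs].
apply/convex_setP => x y t [Px nx] [Py ny] /andP[t0 t1]; split.
  by move/convex_setP : (@conv_hull_convex [set` s]); apply=> //; rewrite t0.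
move=> /esym vE; have [t0'|tn0] := eqVneq t 0.
  by apply: ny; rewrite vE t0' scale0r add0r subr0 scale1r.
have [t1'|tn1] := eqVneq t 1.
  by apply: nx; rewrite vE t1' scale1r subrr scale0r addr0.
have [|xv _] := ext x y t Px Py _ vE.
  by rewrite !lt_neqAle t0 t1 eq_sym tn0 tn1.
exact: nx.
Qed.

End Convexity.

(** * Lattice points of the dual *)

Section IntegralDuality.
Context {d : nat}.
Implicit Types (V W : seq 'rV[int]_d) (a b u v w : 'rV[int]_d).

Definition dotz a b : int := \sum_i a 0 i * b 0 i.

Lemma dotzDl a b v : dotz (a + b) v = dotz a v + dotz b v.
Proof. by rewrite -big_split; apply: eq_bigr => i _; rewrite mxE mulrDl. Qed.

Lemma dotzNl a v : dotz (- a) v = - dotz a v.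
Proof. by rewrite -sumrN; apply: eq_bigr => i _; rewrite mxE mulNr. Qed.

Lemma dotzC a b : dotz a b = dotz b a.
Proof. by apply: eq_bigr => i _; rewrite mulrC. Qed.

Lemma dotzDr a b v : dotz v (a + b) = dotz v a + dotz v b.
Proof. by rewrite ![dotz v _]dotzC dotzDl. Qed.

Lemma dotz0r v : dotz v 0 = 0.
Proof. by apply: big1 => i _; rewrite mxE mulr0. Qed.

Lemma dotz_sumr I (r : seq I) (F : I -> 'rV[int]_d) v :
  dotz v (\sum_(i <- r) F i) = \sum_(i <- r) dotz v (F i).
Proof. exact: (big_morph (dotz v) (fun a b => dotzDr a b v) (dotz0r v)). Qed.

Lemma dotz_self_le0 a : dotz a a <= 0 -> a = 0.
Proof.
move=> aa; apply/rowP => i; rewrite mxE; apply/eqP; rewrite -sqrf_eq0 expr2.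
have a2 j : 0 <= a 0 j * a 0 j by rewrite -expr2 sqr_ge0.
have : dotz a a == 0 by rewrite eq_le aa sumr_ge0.
by rewrite psumr_eq0 // => /allP/(_ i (mem_index_enum _)).
Qed.

(* The lattice points of the [N]-th dilate of the dual of the hull of [V]. *)
Definition polar V (N : nat) w := forall v, v \in V -> dotz w v <= N%:Z.

(** An integral substitute for the origin being interior: it bounds the dual, and it puts small
    multiples of the unit vectors and their opposites in the hull. *)
Definition spanning V := forall u, exists n, nsum V n u.

Definition decomposable V := forall N a, polar V N.+1 a ->
  exists2 q, polar V 1 q & polar V N (a - q).

(** K[P] is generated by all lattice points of P, so [V] must not miss any. Points of the hull pass
    the test against every integral [w] of the dual, so integral tests suffice. *)
Definition saturated V := forall a,
  (forall w, polar V 1 w -> dotz w a <= 1) -> a \in V.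

Lemma nsumP V n a : nsum V n a <->
  exists b : 'I_n -> 'rV[int]_d, (forall i, b i \in V) /\ a = \sum_i b i.
Proof.
elim: n a => [|n IH] a /=; split.
- by move=> ->; exists (fun=> 0); split; [case | rewrite big_ord0].
- by move=> [b [_ ->]]; rewrite big_ord0.
- move=> [v vV /IH[b [bV ab]]].
  exists (fun i => if unlift ord0 i is Some j then b j else v); split=> [i|].
    by case: unliftP.
  rewrite big_ord_recl unlift_none -(subrK v a) ab addrC.
  by congr (_ + _); apply: eq_bigr => i _; rewrite liftK.
- move=> [b [bV ->]]; exists (b ord0) => //; apply/IH.
  by exists (fun i => b (lift ord0 i)); split=> //; rewrite big_ord_recl addrC addKr.
Qed.

Lemma polar_nsum V N w n a : polar V N w -> nsum V n a ->
  dotz w a <= (N * n)%:Z.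
Proof.
move=> wV; elim: n a => [|n IH] a /=; first by move=> ->; rewrite dotz0r muln0.
move=> [v vV /IH IHa]; rewrite -(subrK v a) dotzDr addrC mulnS PoszD.
by apply: lerD IHa; exact: wV.
Qed.

Lemma saturated0 V : saturated V -> 0 \in V.
Proof. by apply=> w _; rewrite dotz0r. Qed.

(** As [w] is itself a sum of points of [V], it may be paired with itself, which gives a nonpositive
    square. *)
Lemma polar0 V w : spanning V -> polar V 0 w -> w = 0.
Proof. by move=> /(_ w)[n nw] /polar_nsum/(_ nw); exact: dotz_self_le0. Qed.

Lemma polar_list V : spanning V ->
  exists W, forall w, w \in W <-> polar V 1 w.
Proof.
move=> spV.
have /choice[n nP] : forall i : 'I_d, exists n, nsum V n (delta_mx 0 i) by move=> i; exact: spV.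
have /choice[m mP] : forall i : 'I_d, exists n, nsum V n (- delta_mx 0 i) by move=> i; exact: spV.
(* The unit vectors and their opposites are sums of points of [V], so the coordinates of [w] lie
   between -N and N; the shift by N makes them ordinals. *)
pose N := (\sum_i n i + \sum_i m i)%N.
pose F (f : {ffun 'I_d -> 'I_(N + N).+1}) : 'rV[int]_d := \row_i ((f i : nat)%:Z - N%:Z).
exists [seq w <- codom F | all (fun v => dotz w v <= 1) V] => w.
rewrite mem_filter; split=> [/andP[/allP wV _] v /wV//|wV].
apply/andP; split; first exact/allP.
have dotz_delta i : dotz w (delta_mx 0 i) = w 0 i.
  rewrite /dotz (bigD1 i) //= big1 => [|j /negbTE nj]; rewrite mxE ?nj ?andbF ?mulr0 //.
  by rewrite !eqxx mulr1 addr0.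
have wN i : - N%:Z <= w 0 i <= N%:Z.
  have := polar_nsum wV (nP i); have := polar_nsum wV (mP i).
  rewrite [dotz _ (- _)]dotzC dotzNl dotzC !dotz_delta !mul1n.
  have : (n i <= \sum_i n i)%N by rewrite (bigD1 i) //= leq_addr.
  have : (m i <= \sum_i m i)%N by rewrite (bigD1 i) //= leq_addr.
  rewrite /N; lia.
apply/codomP; exists [ffun i : 'I_d => inord `|(w 0 i + N%:Z)%R|%N].
by apply/rowP => i; rewrite !mxE ffunE inordK; have := wN i;
  move: (w 0 i) => z /andP[]; clear; lia.
Qed.

Lemma polar_nsum_list V W N a : spanning V -> decomposable V ->
  (forall w, w \in W <-> polar V 1 w) -> polar V N a -> nsum W N a.
Proof.
move=> spV decV WP; elim: N a => [|N IH] a aN; first exact: polar0 aN.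
by have [q /WP qW /IH] := decV N a aN; exists q.
Qed.

End IntegralDuality.

(** * From lattice points to a reflexive polytope with normal dual *)

Section PolytopeOfPoints.
Context (R : realType) {d : nat} (V : seq 'rV[int]_d).
Hypotheses (d_gt0 : (0 < d)%N) (spV : spanning V).
Hypotheses (decV : decomposable V) (satV : saturated V).
Local Notation toR := (@toR R d).
Implicit Types (a b u v w : 'rV[int]_d) (x y : 'rV[R]_d).

Let P := conv_hull [set` map toR V].

Lemma inner_toR a b : inner (toR a) (toR b) = (dotz a b)%:~R.
Proof. by rewrite rmorph_sum; apply: eq_bigr => i _; rewrite !mxE rmorphM. Qed.

Lemma inner_combr x y z (t : R) :
  inner x (t *: y + (1 - t) *: z) = t * inner x y + (1 - t) * inner x z.
Proof.
by rewrite !mulr_sumr -big_split; apply: eq_bigr => i _ /=; rewrite !mxE; ring.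
Qed.

Lemma inner_combl x y z (t : R) :
  inner (t *: y + (1 - t) *: z) x = t * inner y x + (1 - t) * inner z x.
Proof.
by rewrite !mulr_sumr -big_split; apply: eq_bigr => i _ /=; rewrite !mxE; ring.
Qed.

Lemma convex_comb_le1 (t u v : R) : 0 <= t <= 1 -> u <= 1 -> v <= 1 ->
  t * u + (1 - t) * v <= 1.
Proof. move=> /andP[t0 t1] u1 v1; nra. Qed.

Lemma dual_hullP x : dual P x <-> forall v, v \in V -> inner x (toR v) <= 1.
Proof.
split=> [xP v vV|xV]; first by apply/xP; apply: sub_conv_hull; exact: map_f.
apply: (conv_hull_min (C := [set y | inner x y <= 1])).
  by apply/convex_setP => y z t /= y1 z1 t01; rewrite inner_combr convex_comb_le1.
by move=> _ /mapP[v vV ->]; exact: xV.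
Qed.

Lemma dual_hull_convex : convex_set (dual P).
Proof.
apply/convex_setP => x y t /dual_hullP x1 /dual_hullP y1 t01.
by apply/dual_hullP => v vV; rewrite inner_combl convex_comb_le1 ?x1 ?y1.
Qed.

Lemma inner_toR_le a b (n : nat) : (inner (toR a) (toR b) <= n%:R) = (dotz a b <= n%:Z).
Proof. by rewrite inner_toR -[n%:R]/((n%:Z)%:~R) ler_int. Qed.

Lemma dual_hull_int w : dual P (toR w) <-> polar V 1 w.
Proof.
split=> [/dual_hullP wP v vV|wV]; first by rewrite -inner_toR_le wP.
by apply/dual_hullP => v vV; rewrite (inner_toR_le _ _ 1); exact: wV.
Qed.

Lemma hull_int a : P (toR a) <-> a \in V.
Proof.
split=> [Pa|aV]; last by apply: sub_conv_hull; exact: map_f.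
apply: satV => w /dual_hull_int wP.
rewrite dotzC -(inner_toR_le _ _ 1).
by rewrite /inner; under eq_bigr do rewrite mulrC; exact: wP.
Qed.

Lemma toR_sum I (r : seq I) (F : I -> 'rV[int]_d) :
  toR (\sum_(i <- r) F i) = \sum_(i <- r) toR (F i).
Proof. exact: raddf_sum. Qed.

Lemma average_nsum C (W : seq 'rV[int]_d) n a : convex_set C ->
  (forall w, w \in W -> C (toR w)) -> nsum W n.+1 a -> C (n.+1%:R^-1 *: toR a).
Proof.
move=> cC CW /nsumP[b [bW ->]]; rewrite toR_sum scaler_sumr.
apply: convex_sum => // [|i]; last exact/CW/bW.
by rewrite sumr_const card_ord -[LHS]mulr_natr mulVf // pnatr_eq0.
Qed.

Lemma dual_hullE W : (forall w, w \in W <-> polar V 1 w) ->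
  dual P = conv_hull [set` map toR W].
Proof.
move=> WP; apply/seteqP; split=> [y yP|]; last first.
  apply: conv_hull_min; first exact: dual_hull_convex.
  by move=> _ /mapP[w /WP wV ->]; apply/dual_hull_int.
apply: (@conv_hull_closed R d (map toR W)) => B /nbhs_ballP[e /= e0 yB].
(* [M] bounds the change that rounding down the coordinates makes in the inner product with any
   point of V. So the rounding of n.+1 times y lies in the dilate by n.+1 + M. *)
pose M := (\sum_(v <- V) \sum_i `|v ord0 i|)%N.
pose c := \sum_i `|y 0 i|.
have c0 : 0 <= c by exact: sumr_ge0.
(* In each coordinate the approximation a / N differs from y by at most (M c + 1) / N, and N exceeds
   n. *)
have [n nc] : exists n, (M%:R * c + 1) / e < n%:R.
  exists (Num.trunc ((M%:R * c + 1) / e)).+1.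
  by have /andP[] := truncn_itv (divr_ge0 (addr_ge0 (mulr_ge0 (ler0n R M) c0) ler01) (ltW e0)).
pose a : 'rV[int]_d := \row_i Num.floor (n.+1%:R * y 0 i).
pose N := (n.+1 + M)%N.
have aN : polar V N a.
  move=> v vV; rewrite -inner_toR_le.
  have vM : \sum_i `|(v 0 i)%:~R| <= M%:R :> R.
    rewrite /M (big_rem v) //= natrD natr_sum -[leLHS]addr0 lerD //.
    by apply: ler_sum => i _; rewrite natr_absz -intr_norm.
  rewrite /N natrD -[n.+1%:R]mulr1.
  apply: le_trans (_ : n.+1%:R * inner y (toR v) + \sum_i `|(v 0 i)%:~R| <= _); last first.
    by apply: lerD => //; apply: ler_wpM2l => //; move/dual_hullP : yP; exact.
  rewrite mulr_sumr -big_split; apply: ler_sum => i _ /=; rewrite !mxE.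
  have /andP[f1 f2] := floor_itv (n.+1%:R * y 0 i).
  rewrite mulrA -lerBlDl -mulrBl; apply: le_trans (ler_norm _) _.
  rewrite normrM ler_piMl // distrC ger0_norm ?subr_ge0 //.
  by rewrite lerBlDl ltW // -intrD1.
have N0 : 0 < N%:R :> R by rewrite ltr0n.
exists (N%:R^-1 *: toR a); split.
  rewrite /N addSn; apply: (average_nsum (W := W)).
  - exact: conv_hull_convex.
  - by move=> w wW; apply: sub_conv_hull; exact: map_f.
  - by rewrite -addSn; exact: (polar_nsum_list spV decV WP).
apply: yB; split=> // j i; rewrite !mxE ord1 /ball /= /ball_.
have /andP[f1 f2] := floor_itv (n.+1%:R * y 0 i).
set f := (Num.floor _)%:~R in f1 f2 *.
have -> : y 0 i - N%:R^-1 * f = (N%:R * y 0 i - f) / N%:R.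
  by field; rewrite gt_eqF.
have yc : `|y 0 i| <= c by rewrite /c (bigD1 i) //= lerDl sumr_ge0.
rewrite normrM normfV (gtr0_norm N0) ltr_pdivrMr //.
have -> : N%:R * y 0 i - f = M%:R * y 0 i + (n.+1%:R * y 0 i - f).
  by rewrite /N natrD; ring.
apply: le_lt_trans (ler_normD _ _) _.
apply: (@le_lt_trans _ _ (M%:R * c + 1)).
  apply: lerD; first by rewrite normrM ger0_norm // ler_wpM2l.
  by rewrite ger0_norm ?subr_ge0 // lerBlDl ltW // -intrD1.
rewrite -ltr_pdivrMl // mulrC; apply: lt_le_trans nc _.
by rewrite ler_nat /N addSn leqW // leq_addr.
Qed.

Lemma hull_scale t x : 0 <= t <= 1 -> P x -> P (t *: x).
Proof.
move=> t01 Px; have P0 : P 0.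
  have -> : 0 = toR 0 by apply/rowP => i; rewrite !mxE.
  exact/hull_int/saturated0.
move/convex_setP : (@conv_hull_convex R d [set` map toR V]) => /(_ x 0 t Px P0 t01).
by rewrite scaler0 addr0.
Qed.

Lemma hull_axes : exists2 e : R, 0 < e &
  forall (i : 'I_d) (c : R), `|c| <= e -> P (c *: delta_mx 0 i).
Proof.
have axis (s : int) (i : 'I_d) : s != 0 ->
    exists n, P (n.+1%:R^-1 *: toR (s *: delta_mx 0 i)).
  move=> s0; have [[|n] ns] := spV (s *: delta_mx 0 i).
    move/rowP : ns => /(_ i); rewrite !mxE !eqxx mulr1 => s0'.
    by rewrite s0' eqxx in s0.
  exists n; apply: (average_nsum (W := V)) ns; first exact: conv_hull_convex.
  by move=> w wV; apply/hull_int.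
have /choice[n nP] : forall i, exists n, P (n.+1%:R^-1 *: toR (1 *: delta_mx 0 i)).
  by move=> i; exact: axis.
have /choice[m mP] : forall i, exists n, P (n.+1%:R^-1 *: toR ((-1) *: delta_mx 0 i)).
  by move=> i; exact: axis.
pose N := (\sum_i n i + \sum_i m i)%N.+1.
have N0 : 0 < N%:R :> R by rewrite ltr0n.
exists N%:R^-1 => [|i c]; first by rewrite invr_gt0.
have scaleP (s : int) (k : nat) : (k.+1 <= N)%N -> `|c| <= N%:R^-1 ->
    c = `|c| * s%:~R -> P (k.+1%:R^-1 *: toR (s *: delta_mx 0 i)) ->
    P (c *: delta_mx 0 i).
  move=> kN cN cE Pk.
  have -> : c *: delta_mx 0 i = (`|c| * k.+1%:R) *: (k.+1%:R^-1 *: toR (s *: delta_mx 0 i)).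
    rewrite scalerA mulfK ?pnatr_eq0 // {1}cE -scalerA; congr (_ *: _).
    by apply/rowP => j; rewrite !mxE rmorphM rmorph_nat.
  apply: hull_scale Pk; rewrite mulr_ge0 //=.
  apply: le_trans (ler_wpM2r (ler0n _ _) cN) _.
  by rewrite mulrC ler_pdivrMr // mul1r ler_nat.
move=> cN; have [c0|c0] := leP 0 c.
  apply: (scaleP 1 (n i)) => //; last by rewrite ger0_norm // mulr1.
  by rewrite ltnS (bigD1 i) //= -addnA leq_addr.
apply: (scaleP (-1) (m i)) => //; last by rewrite ltr0_norm // mulrN1 opprK.
by rewrite ltnS addnC (bigD1 i) //= -addnA leq_addr.
Qed.

Lemma hull_interior : P° 0.
Proof.
have [e e0 eP] := hull_axes.
have d0 : 0 < d%:R :> R by rewrite ltr0n.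
apply/nbhs_ballP; exists (e / d%:R) => /=; first exact: divr_gt0.
move=> x [_ xe]; rewrite [x]row_sum_delta.
(* x is the average of its d axis components, each stretched by d. *)
have -> : \sum_(i < d) x 0 i *: delta_mx 0 i =
    \sum_(i < d) d%:R^-1 *: ((d%:R * x 0 i) *: delta_mx 0 i) :> 'rV[R]_d.
  by apply: eq_bigr => i _; rewrite scalerA mulKf // gt_eqF.
apply: convex_sum => [|i||i].
- exact: conv_hull_convex.
- by rewrite invr_ge0.
- by rewrite sumr_const card_ord -[LHS]mulr_natr mulVf // gt_eqF.
- apply: eP; rewrite normrM gtr0_norm // mulrC -ler_pdivlMr // ltW //.
  by have := xe 0 i; rewrite /ball /= /ball_ mxE sub0r normrN.
Qed.

Lemma hull_has_dim : has_dim P d.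
Proof.
have [e e0 eP] := hull_axes.
split; first by exists 0; have /interior_subset := hull_interior.
exists fullv; split=> [|x y _ _|U PU]; first by rewrite dimvf /= /dim /= mul1n.
  exact: memvf.
apply/subvP => x _; rewrite [x]row_sum_delta; apply: rpred_sum => i _.
apply: rpredZ.
have -> : delta_mx 0 i = e^-1 *: (e *: delta_mx 0 i - 0 *: delta_mx 0 i) :> 'rV[R]_d.
  by rewrite scale0r subr0 scalerA mulVf ?scale1r // gt_eqF.
by apply/rpredZ/PU; apply: eP; rewrite ?normr0 ?gtr0_norm // ltW.
Qed.

Lemma lattice_polytope_points W : lattice_polytope (conv_hull [set` map toR W]).
Proof.
split; first by exists (map toR W).
by move=> v /vertex_conv_hull_seq/mapP[a _ ->]; exists a.
Qed.

Theorem reflexive_normal_hull :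
  [/\ reflexive_polytope P, normal_polytope (dual P) & forall a, P (toR a) <-> a \in V].
Proof.
have [W WP] := polar_list spV.
have latQ : lattice_polytope (dual P).
  by rewrite (dual_hullE WP); exact: lattice_polytope_points.
split; last exact: hull_int.
- split=> //; [exact: lattice_polytope_points | exact: hull_has_dim |
    exact: hull_interior].
- split=> // N a N0 [x /dual_hullP xP xa].
  have aN : polar V N a.
    move=> v vV; rewrite -inner_toR_le -xa.
    have -> : inner (N%:R *: x) (toR v) = N%:R * inner x (toR v).
      by rewrite mulr_sumr; apply: eq_bigr => i _; rewrite mxE mulrA.
    by rewrite -[leRHS]mulr1 ler_wpM2l // xP.
  have /nsumP[b [bW ->]] := polar_nsum_list spV decV WP aN.
  by exists b; split=> // i; apply/dual_hull_int/WP.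
Qed.

End PolytopeOfPoints.

(** * Raising the dimension *)

Record good_points d (V ys : seq 'rV[int]_d) n u : Prop := GoodPoints {
  good_spanning : spanning V;
  good_decomposable : decomposable V;
  good_saturated : saturated V;
  good_certificate : depth_certificate V ys n u }.

Section ExtendVectors.
Context {d : nat}.
Implicit Types (a b v w : 'rV[int]_d) (c k : int).

Definition ext c v : 'rV[int]_(1 + d) := row_mx (const_mx c : 'rV_1) v.

Lemma extD c k v w : ext c v + ext k w = ext (c + k) (v + w).
Proof. by rewrite add_row_mx; congr row_mx; apply/rowP => i; rewrite !mxE. Qed.

Lemma extN c v : - ext c v = ext (- c) (- v).
Proof. by rewrite opp_row_mx; congr row_mx; apply/rowP => i; rewrite !mxE. Qed.

Lemma extB c k v w : ext c v - ext k w = ext (c - k) (v - w).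
Proof. by rewrite extN extD. Qed.

Lemma ext0 : ext 0 0 = 0.
Proof. by rewrite -[RHS](@row_mx0 _ 1 1 d). Qed.

Lemma extI c k v w : ext c v = ext k w -> c = k /\ v = w.
Proof. by move=> /eq_row_mx[/rowP/(_ 0)]; rewrite !mxE. Qed.

Lemma ext_eq c k v w : (ext c v == ext k w) = (c == k) && (v == w).
Proof.
by apply/eqP/andP => [/extI[-> ->]//|[/eqP-> /eqP->]].
Qed.

Lemma extP (u : 'rV[int]_(1 + d)) : exists c v, u = ext c v.
Proof.
exists (lsubmx u 0 0), (rsubmx u); rewrite -[LHS]hsubmxK; congr row_mx.
by apply/rowP => i; rewrite ord1 !mxE.
Qed.

Lemma dotz_ext c k v w : dotz (ext c v) (ext k w) = c * k + dotz v w.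
Proof.
rewrite /dotz big_split_ord big_ord1 !row_mxEl !mxE; congr (_ + _).
by apply: eq_bigr => i _; rewrite !row_mxEr.
Qed.

End ExtendVectors.

Lemma dotzB d (a b v : 'rV[int]_d) : dotz (a - b) v = dotz a v - dotz b v.
Proof. by rewrite dotzDl dotzNl. Qed.

Lemma dotz0l d (v : 'rV[int]_d) : dotz 0 v = 0.
Proof. by rewrite dotzC dotz0r. Qed.

Lemma dotzNr d (a v : 'rV[int]_d) : dotz v (- a) = - dotz v a.
Proof. by rewrite dotzC dotzNl dotzC. Qed.

(** For large N the vector [u] lies in the N-th dilate of the dual, so it is a sum of dual lattice
    points; pairing this sum with [u] gives a nonpositive square. *)
Lemma polar_le0_eq0 d (V : seq 'rV[int]_d) u : spanning V -> decomposable V ->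
  (forall w, polar V 1 w -> dotz w u <= 0) -> u = 0.
Proof.
move=> spV decV u0; apply: dotz_self_le0.
have [W WP] := polar_list spV.
have uN : polar V (\sum_(v <- V) `|dotz u v|) u.
  move=> v vV; rewrite (big_rem v) //=; lia.
have /nsumP[b [bW ub]] := polar_nsum_list spV decV WP uN.
rewrite {2}ub dotz_sumr; apply: sumr_le0 => i _.
by rewrite dotzC; apply/u0/WP.
Qed.

(* The hull of V and of the two points y +- e, where e is the new unit vector.
   Its toric ring is K[V][p, q] / (pq - y^2). *)
Section SkewBipyramid.
Context {d : nat} (V : seq 'rV[int]_d) (y : 'rV[int]_d) (yV : y \in V).
Implicit Types (a b v w : 'rV[int]_d) (k : int) (W : seq 'rV[int]_d).

Definition bipyramid : seq 'rV[int]_(1 + d) :=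
  ext 1 y :: ext (-1) y :: [seq ext 0 v | v <- V].

Lemma nsum_nat n : nsum V n (y *+ n).
Proof.
elim: n => [|n IH] /=; first by rewrite mulr0n.
by exists y => //; rewrite mulrS addrAC subrr add0r.
Qed.

Lemma ext_bipyramid v : v \in V -> ext 0 v \in bipyramid.
Proof. by move=> vV; rewrite !inE map_f ?orbT. Qed.

Lemma mem_ext_cons W u : u \in ext 1 y :: ext (-1) y :: [seq ext 0 v | v <- W] ->
  (exists2 s, u = ext s y & s = 1 \/ s = -1) \/ exists2 v, v \in W & u = ext 0 v.
Proof.
rewrite !inE => /or3P[/eqP->|/eqP->|/mapP[v vV ->]]; last by right; exists v.
- by left; exists 1 => //; left.
- by left; exists (-1) => //; right.
Qed.

(** Two opposite apices can be traded for two copies of [y]. So at height [k] it is enough to use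
    one apex, |k| times. *)
Lemma nsum_bipyramid n k a :
  nsum bipyramid n (ext k a) <->
  (`|k| <= n)%N /\ nsum V (n - `|k|) (a - y *+ `|k|).
Proof.
split.
  elim: n k a => [|n IH] k a.
    by rewrite /= -ext0 => /extI[-> ->]; rewrite absz0 mulr0n subr0.
  move=> [u /mem_ext_cons[[s -> s1]|[v vV ->]]]; rewrite extB => /IH[kn]; last first.
    rewrite subr0 in kn *; move=> ak; split; first lia.
    by rewrite subSn //; exists v => //; rewrite addrAC.
  have [E|E] : `|k|%N = `|(k - s)%R|.+1 \/ `|(k - s)%R|%N = `|k|.+1 by lia.
    by rewrite E subSS mulrS opprD addrA; split.
  (* The new apex meets an opposite one: the pair becomes two copies of y. *)
  rewrite E => ak; split; first lia.
  have -> : (n.+1 - `|k|)%N = (n - `|k|.+1 + 2)%N by lia.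
  have -> : a - y *+ `|k| = a - y - y *+ `|k|.+1 + y *+ 2.
    by rewrite mulrS mulr2n opprD !addrA !(addrAC _ (- (y *+ `|k|)) y) !subrK.
  exact/nsumD/nsum_nat.
move=> [kn]; have [m -> {kn}] : exists m, n = (`|k| + m)%N.
  by exists (n - `|k|)%N; rewrite subnKC.
rewrite addKn.
have [j kj] : exists j, `|k|%N = j by exists `|k|%N.
rewrite kj; elim: j k a kj => [|j IH] k a kj am.
  have -> : k = 0 by lia.
  rewrite mulr0n subr0 in am; elim: m a am => [|m IHm] a /=; first by move=> ->; rewrite ext0.
  move=> [v vV /IHm avm]; exists (ext 0 v); first exact: ext_bipyramid.
  by rewrite extB subr0.
pose s : int := if 0 < k then 1 else -1.
exists (ext s y); first by rewrite /bipyramid /s; case: ifP; rewrite !inE eqxx ?orbT.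
rewrite extB; apply: IH; first by rewrite /s; case: ifP; lia.
by rewrite -addrA -opprD -mulrS.
Qed.

Lemma spanning_bipyramid : spanning V -> spanning bipyramid.
Proof.
move=> spV u; have [k [a ->]] := extP u; have [n an] := spV (a - y *+ `|k|).
by exists (n + `|k|)%N; apply/nsum_bipyramid; rewrite leq_addl addnK.
Qed.

Lemma polar_bipyramid N c w :
  polar bipyramid N (ext c w) <-> polar V N w /\ `|c| <= N%:Z - dotz w y.
Proof.
split=> [wN|[wN cN] u /mem_ext_cons[[s -> s1]|[v vV ->]]]; rewrite ?dotz_ext.
- split=> [v vV|]; first by have := wN _ (ext_bipyramid vV); rewrite dotz_ext mulr0 add0r.
  have := wN (ext 1 y); have := wN (ext (-1) y).
  rewrite !dotz_ext !inE !eqxx !orbT => /(_ isT) h1 /(_ isT) h2; lia.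
- by case: s1 => ->; lia.
- by rewrite mulr0 add0r; exact: wN.
Qed.

Lemma decomposable_bipyramid : decomposable V -> decomposable bipyramid.
Proof.
move=> decV N u; have [c [w ->]] := extP u => /polar_bipyramid[wN cN].
have [q q1 wq] := decV N w wN; have := q1 y yV; have := wq y yV.
rewrite dotzB => wqy qy.
pose m1 := 1 - dotz q y; pose m2 := N%:Z - (dotz w y - dotz q y).
(* The absolute value of c is at most m1 + m2; clamping c to the interval from -m1 to m1 leaves a
   rest of at most m2. *)
pose b := Num.max (- m1) (Num.min m1 c).
have [bm1 bm2] : `|b| <= m1 /\ `|c - b| <= m2.
  rewrite /b; move: cN qy wqy; rewrite /m1 /m2; lia.
exists (ext b q); first by apply/polar_bipyramid.
by rewrite extB; apply/polar_bipyramid; split=> //; rewrite dotzB.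
Qed.

Lemma saturated_bipyramid : spanning V -> decomposable V -> saturated V ->
  saturated bipyramid.
Proof.
move=> spV decV satV u; have [k [a ->]] := extP u => ka.
(* For a given w the strongest test has the largest possible new coordinate, with the sign of k. *)
have {}ka w : polar V 1 w -> (1 - dotz w y) * `|k| + dotz w a <= 1.
  move=> w1; have wy := w1 y yV; have [k0|k0] := ltP 0 k.
    have := ka (ext (1 - dotz w y) w); rewrite dotz_ext gtr0_norm //; apply.
    by apply/polar_bipyramid; split=> //; rewrite ger0_norm // subr_ge0.
  have := ka (ext (dotz w y - 1) w); rewrite dotz_ext -opprB mulNr -mulrN ler0_norm //.
  by apply; apply/polar_bipyramid; split=> //; rewrite normrN ger0_norm // subr_ge0.
have k1 : `|k| <= 1.
  have polar0 : polar V 1 0 by move=> v _; rewrite dotz0l.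
  by have := ka 0 polar0; rewrite (dotz0l y) (dotz0l a); lia.
have [k0|k0] := eqVneq k 0.
  rewrite k0; apply/ext_bipyramid/satV => w /ka.
  by rewrite k0 normr0 mulr0 add0r.
have ay : a = y.
  apply/eqP; rewrite -subr_eq0; apply/eqP/(polar_le0_eq0 spV decV) => w /ka.
  have -> : `|k| = 1 by lia.
  rewrite dotzDr dotzNr; lia.
have [->|->] : k = 1 \/ k = -1 by lia.
  by rewrite ay mem_head.
by rewrite ay !inE eqxx orbT.
Qed.

(** Modulo the two apices the relation becomes y^2 = 0, so the quotient is K[V] / (y^2). A socle
    element modulo (y, ys) times y is then a socle element modulo (y^2, ys), which explains [u + y]
    and [n.+1]. *)
Lemma depth_certificate_bipyramid ys n u :
  depth_certificate V (y :: ys) n u ->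
  depth_certificate bipyramid (ext 1 y :: ext (-1) y :: [seq ext 0 x | x <- ys])
    n.+1 (ext 0 (u + y)).
Proof.
case=> ysV /= /andP[yys uniq_ys] reg un unot usoc.
(* The regularity condition also holds one degree below: there it says that
   distinct points stay distinct. *)
have regZ x x' m b : x \in y :: ys -> x' \in y :: ys -> x != x' ->
    nsum V m (b + x) -> nsum V m (b + x') -> (0 < m)%N /\ nsum V m.-1 b.
  move=> xys x'ys xx'; case: m => [|m] /=; last first.
    by move=> bx bx'; split=> //; exact: (reg x x').
  move=> /eqP; rewrite addr_eq0 => /eqP ->; move=> /eqP.
  by rewrite addrC subr_eq0 eq_sym (negbTE xx').
have yV' : y \in y :: ys by exact: mem_head.
have ysV' x : x \in ys -> x \in y :: ys by move=> xys; rewrite inE xys orbT.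
have yx x : x \in ys -> y != x by move=> xys; apply: contraNneq yys => ->.
have same s k m b : s = 1 \/ s = -1 -> `|(k + s)%R|%N = `|k|.+1 ->
    nsum bipyramid m.+1 (ext k b + ext s y) -> nsum bipyramid m (ext k b).
  move=> s1 E; rewrite extD => /nsum_bipyramid[]; rewrite E subSS mulrS opprD.
  by rewrite addrA addrK => km bm; apply/nsum_bipyramid.
have regx s x m t : s = 1 \/ s = -1 -> x \in ys ->
    nsum bipyramid m.+1 (t + ext s y) -> nsum bipyramid m.+1 (t + ext 0 x) ->
    nsum bipyramid m t.
  move=> s1 xys; have [k [b ->]] := extP t => ty.
  have [E|E] : `|(k + s)%R|%N = `|k|.+1 \/ `|k|%N = `|(k + s)%R|.+1 by lia.
    by move=> _; exact: same E ty.
  move: ty; rewrite !extD addr0 => /nsum_bipyramid[ks by2] /nsum_bipyramid[km bx].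
  move: by2; set c := b - y *+ `|k|.
  have -> : (m.+1 - `|(k + s)%R| = (m.+1 - `|k|).+1)%N by lia.
  have -> : b + y - y *+ `|(k + s)%R| = c + y + y.
    by rewrite /c E mulrS opprD !addrA !(addrAC _ (- (y *+ `|(k + s)%R|)) y) subrK.
  have {}bx : nsum V (m.+1 - `|k|) (c + x) by rewrite /c addrAC.
  (* From c + 2y and c + x + y one gets c + y; then c + y and c + x give c. *)
  move=> by2; have [|/= _ cy] := regZ y x (m.+1 - `|k|).+1 (c + y) yV' (ysV' x xys) (yx x xys) by2.
    by rewrite addrAC -[_.+1]addn1; apply: nsumD bx _; exact: nsum1.
  have [km' cm] := regZ y x _ c yV' (ysV' x xys) (yx x xys) cy bx.
  apply/nsum_bipyramid; split; first lia.
  by move: cm; have -> : ((m.+1 - `|k|).-1 = m - `|k|)%N by lia.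
have regpm s s' m t : s = 1 \/ s = -1 -> s' = 1 \/ s' = -1 -> s != s' ->
    nsum bipyramid m.+1 (t + ext s y) -> nsum bipyramid m.+1 (t + ext s' y) ->
    nsum bipyramid m t.
  move=> s1 s1' ss'; have [k [b ->]] := extP t.
  have [E|E] : `|(k + s)%R|%N = `|k|.+1 \/ `|(k + s')%R|%N = `|k|.+1 by lia.
    by move=> + _; exact: same.
  by move=> _; exact: same.
split.
- move=> z /mem_ext_cons[[s -> [->|->]]|[x xys ->]]; rewrite ?mem_head //.
    by rewrite !inE eqxx orbT.
  by apply/ext_bipyramid/ysV; rewrite inE xys orbT.
- rewrite /= !inE !ext_eq negb_or /=; apply/and3P; split.
  + by apply/mapP => -[x _ /extI[]].
  + by apply/mapP => -[x _ /extI[]].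
  + by rewrite map_inj_uniq // => x x' /extI[].
- move=> z z' /mem_ext_cons[[s -> s1]|[x xys ->]] /mem_ext_cons[[s' -> s1']|[x' xys' ->]] zz' m t.
  + by apply: regpm => //; apply: contraNneq zz' => ->.
  + exact: regx.
  + by move=> tx ty; exact: regx ty tx.
  + have xx' : x != x' by apply: contraNneq zz' => ->.
    have [k [b ->]] := extP t; rewrite !extD addr0.
    move=> /nsum_bipyramid[km bx] /nsum_bipyramid[_ bx'].
    rewrite addrAC in bx; rewrite addrAC in bx'.
    have [km' cm] := regZ x x' _ _ (ysV' _ xys) (ysV' _ xys') xx' bx bx'.
    apply/nsum_bipyramid; split; first lia.
    by move: cm; have -> : ((m.+1 - `|k|).-1 = m - `|k|)%N by lia.
- apply/nsum_bipyramid; rewrite absz0 mulr0n !subr0 subn0; split=> //.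
  by rewrite -addn1; apply: nsumD un _; exact: nsum1.
- move=> [z /mem_ext_cons[[s -> s1]|[x xys ->]]]; rewrite extB => /nsum_bipyramid.
    have -> : `|(0 - s)%R|%N = 1%N by lia.
    rewrite mulr1n addrK => -[n0 uy]; apply: unot; case: n n0 uy {un usoc} => // n _.
    by rewrite subn1 => uy; exists y.
  rewrite subr0 absz0 mulr0n subn0 subr0 => -[_ uyx].
  have uxx : nsum V n (u - x + x) by rewrite subrK.
  rewrite addrAC in uyx.
  have [n0 ux] := regZ y x n (u - x) yV' (ysV' _ xys) (yx _ xys) uyx uxx.
  by apply: unot; case: n n0 ux {un usoc uyx uxx} => // n _ ux; exists x => //; exact: ysV'.
- move=> z /mem_ext_cons[[s -> s1]|[v vV ->]].
    exists (ext s y); first by case: s1 => ->; rewrite !inE eqxx ?orbT.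
    rewrite addrK; apply/nsum_bipyramid; rewrite absz0 mulr0n subn0 subr0; split=> //.
    by rewrite -addn1; apply: nsumD un _; exact: nsum1.
  have [x] := usoc v vV; rewrite inE => /predU1P[->|xys] uvx.
    exists (ext 1 y); first exact: mem_head.
    rewrite extD extB; apply/nsum_bipyramid; split=> //.
    by rewrite addr0 sub0r subn1 /= mulr1n (addrAC u) addrK.
  exists (ext 0 x); first by rewrite !inE map_f ?orbT.
  rewrite extD extB addr0 subr0; apply/nsum_bipyramid; split=> //.
  rewrite absz0 mulr0n subn0 subr0 !(addrAC _ y) -addn1.
  by apply: nsumD uvx _; exact: nsum1.
Qed.

Lemma good_bipyramid ys n (u : 'rV[int]_d) : good_points V (y :: ys) n u ->
  good_points bipyramid (ext 1 y :: ext (-1) y :: [seq ext 0 x | x <- ys])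
    n.+1 (ext 0 (u + y)).
Proof.
case=> spV decV satV cert; split; [exact: spanning_bipyramid |
  exact: decomposable_bipyramid | exact: saturated_bipyramid |
  exact: depth_certificate_bipyramid].
Qed.

End SkewBipyramid.

(** * Prisms *)

Section Prism.
Context {d : nat} (V : seq 'rV[int]_d).
Implicit Types (a b v w : 'rV[int]_d) (k : int).

Definition prism : seq 'rV[int]_(1 + d) :=
  [seq ext k v | k <- [:: 0; 1; -1], v <- V].

Lemma prismP k v : (ext k v \in prism) = (`|k| <= 1) && (v \in V).
Proof.
apply/allpairsP/andP => [[[c w] /= [cI wV /extI[-> ->]]]|[k1 vV]].
  by split=> //; move: cI; rewrite !inE => /or3P[]/eqP->.
by exists (k, v); split=> //=; rewrite !inE; lia.
Qed.

Lemma nsum_prism n k a :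
  nsum prism n (ext k a) <-> (`|k| <= n)%N /\ nsum V n a.
Proof.
elim: n k a => [|n IH] k a /=; split.
- by rewrite -ext0 => /extI[-> ->].
- by move=> [k0 ->]; rewrite (_ : k = 0) ?ext0 //; lia.
- move=> [u]; have [c [v ->]] := extP u; rewrite prismP extB => /andP[c1 vV].
  by move=> /IH[kc av]; split; [lia | exists v].
- move=> [kn [v vV av]].
  pose c : int := if k == 0 then 0 else if 0 < k then 1 else -1.
  exists (ext c v); first by rewrite prismP vV /c; case: eqP => // _; case: ifP.
  rewrite extB; apply/IH; split=> //.
  by rewrite /c; case: eqP => k0; [|case: ifP => k1]; lia.
Qed.

Lemma spanning_prism : spanning V -> 0 \in V -> spanning prism.
Proof.
move=> spV V0 u; have [k [a ->]] := extP u; have [n an] := spV a.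
exists (`|k| + n)%N; apply/nsum_prism; split; first exact: leq_addr.
by rewrite -[a]add0r; apply: nsumD an; have := nsum_nat V0 `|k|; rewrite mul0rn.
Qed.

Lemma polar_prism N c w : V != [::] ->
  polar prism N (ext c w) <-> forall v, v \in V -> `|c| + dotz w v <= N%:Z.
Proof.
move=> Vn; split=> [wN v vV|wN u].
  have := wN (ext 1 v); have := wN (ext (-1) v).
  rewrite !dotz_ext !prismP vV /= => /(_ isT) h1 /(_ isT) h2; lia.
have [k [v ->]] := extP u; rewrite prismP dotz_ext => /andP[k1 /wN].
have [->|[->|->]] : k = 0 \/ k = 1 \/ k = -1 by lia.
all: lia.
Qed.

Lemma decomposable_prism : decomposable V -> 0 \in V -> decomposable prism.
Proof.
move=> decV V0 N u; have Vn : V != [::] by case: (V) V0.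
have [c [w ->]] := extP u => /(polar_prism _ _ _ Vn) wN.
have [c0|cn0] := eqVneq c 0.
  have [|q q1 wq] := decV N w; first by move=> v /wN; rewrite c0; lia.
  exists (ext 0 q); first by apply/polar_prism => // v /q1; lia.
  by rewrite extB c0; apply/polar_prism => // v /wq; lia.
(* The dual point s e, with e the new unit vector, lowers the absolute value of c by one and leaves
   w alone. *)
pose s : int := if 0 < c then 1 else -1.
exists (ext s 0).
  by apply/polar_prism => // v _; rewrite dotz0l /s; case: ifP; lia.
rewrite extB subr0; apply/polar_prism => // v /wN; rewrite /s; case: ifP; lia.
Qed.

Lemma saturated_prism : saturated V -> saturated prism.
Proof.
move=> satV; have V0 := saturated0 satV.
have Vn : V != [::] by case: (V) V0.
move=> u; have [k [a ->]] := extP u => ka; rewrite prismP.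
have k1 s : `|s| = 1 -> s * k <= 1.
  move=> s1; have := ka (ext s 0); rewrite dotz_ext dotz0l addr0; apply.
  by apply/polar_prism => // v _; rewrite dotz0l s1.
apply/andP; split; first by have := k1 1 erefl; have := k1 (-1) erefl; lia.
apply: satV => w w1; have := ka (ext 0 w); rewrite dotz_ext mul0r add0r; apply.
by apply/polar_prism => // v /w1; lia.
Qed.

(** With a single point the regularity condition is empty. The socle condition survives because the
    new coordinate of a point is at most 1 in absolute value, and height n >= 1 leaves room for
    it. *)
Lemma good_prism y n u : (0 < n)%N -> good_points V [:: y] n u ->
  good_points prism [:: ext 0 y] n (ext 0 u).
Proof.
move=> n0 [spV decV satV [ysV _ _ un unot usoc]].
have V0 := saturated0 satV.
split; [exact: spanning_prism | exact: decomposable_prism |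
  exact: saturated_prism |].
split=> //.
- by move=> z; rewrite !inE => /eqP->; rewrite prismP ysV ?mem_head.
- by move=> z z'; rewrite !inE => /eqP-> /eqP->; rewrite eqxx.
- by apply/nsum_prism.
- case: n n0 unot {un usoc} => // n _ unot [z]; rewrite inE => /eqP ->.
  by rewrite extB => /nsum_prism[_ uy]; apply: unot; exists y; rewrite ?mem_head.
- move=> z; have [c [v ->]] := extP z; rewrite prismP => /andP[c1 vV].
  have [x] := usoc v vV; rewrite inE => /eqP -> uvy.
  exists (ext 0 y); first exact: mem_head.
  by rewrite extD extB; apply/nsum_prism; split=> //; lia.
Qed.

End Prism.

(** * Polytopes of dimension 4 *)

Lemma nsum_char d (V : seq 'rV[int]_d) (D : nat -> 'rV[int]_d -> Prop) :
  (forall a, D 0%N a <-> a = 0) ->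
  (forall n a v, v \in V -> D n a -> D n.+1 (a + v)) ->
  (forall n a, D n.+1 a -> exists2 v, v \in V & D n (a - v)) ->
  forall n a, nsum V n a <-> D n a.
Proof.
move=> D0 Dadd Dsub; elim=> [|n IH] a /=; first by symmetry; exact: D0.
split=> [[v vV /IH/(Dadd _ _ _ vV)]|/Dsub[v vV /IH av]]; last by exists v.
by rewrite subrK.
Qed.

Section FourSpace.
Implicit Types (a b c e : int) (s : seq (int * int * int * int)).

Definition vec4 a b c e : 'rV[int]_4 := ext a (ext b (ext c (ext e 0))).

Lemma vec4P (u : 'rV[int]_4) : exists a b c e, u = vec4 a b c e.
Proof.
have [a [u1 ->]] := @extP 3 u; have [b [u2 ->]] := @extP 2 u1.
have [c [u3 ->]] := @extP 1 u2; have [e [u4 ->]] := @extP 0 u3.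
by exists a, b, c, e; rewrite /vec4 (thinmx0 u4).
Qed.

Lemma vec4D a b c e a' b' c' e' :
  vec4 a b c e + vec4 a' b' c' e' = vec4 (a + a') (b + b') (c + c') (e + e').
Proof. by rewrite /vec4 !extD addr0. Qed.

Lemma vec4B a b c e a' b' c' e' :
  vec4 a b c e - vec4 a' b' c' e' = vec4 (a - a') (b - b') (c - c') (e - e').
Proof. by rewrite /vec4 !extB subr0. Qed.

Lemma vec4_0 : vec4 0 0 0 0 = 0.
Proof. by rewrite /vec4 !ext0. Qed.

Lemma vec4I a b c e a' b' c' e' : vec4 a b c e = vec4 a' b' c' e' ->
  [/\ a = a', b = b', c = c' & e = e'].
Proof. by move=> /extI[-> /extI[-> /extI[-> /extI[-> _]]]]. Qed.

Lemma dotz_vec4 a b c e a' b' c' e' :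
  dotz (vec4 a b c e) (vec4 a' b' c' e') = a * a' + b * b' + c * c' + e * e'.
Proof. by rewrite !dotz_ext dotz0r addr0 !addrA. Qed.

Lemma vec4_eq a b c e a' b' c' e' :
  (vec4 a b c e == vec4 a' b' c' e') = [&& a == a', b == b', c == c' & e == e'].
Proof. by rewrite /vec4 !ext_eq eqxx andbT. Qed.

Definition fiber a n b c e := [seq vec4 (a + i%:Z) b c e | i <- iota 0 n].

Lemma mem_fiber a n b c e z b' c' e' : (vec4 z b' c' e' \in fiber a n b c e) =
  [&& b' == b, c' == c, e' == e & a <= z < a + n%:Z].
Proof.
apply/mapP/and4P => [[i]|[/eqP-> /eqP-> /eqP-> zn]].
  by rewrite mem_iota => i_n /vec4I[-> -> -> ->]; rewrite !eqxx; split=> //; lia.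
by exists `|(z - a)%R|%N; [rewrite mem_iota; lia | congr vec4; lia].
Qed.

End FourSpace.

(** * A polytope of depth 4 *)

Section DepthFour.

(** The points (-2,-1,0,0), (0,0,1,0), (0,0,0,1), (-1,2,-1,-1) and (-1,0,0,0) lie on one facet, and
    twice the first plus the next three is five times the last. So over g = h = i = 0 the point
    (-1,2,-1,-1) is usable only from height 5 on. *)
Definition Y_points := fiber (-2) 6 (-1) 0 0 ++ fiber (-1) 3 0 0 0 ++
  [:: vec4 0 0 1 0; vec4 0 0 0 1; vec4 (-1) 2 (-1) (-1)].

(* k is the number of times the last point of [Y_points] is used. *)
Definition inY (n : nat) (z g h i : int) := exists k : int,
  [/\ 0 <= k /\ - h <= k, - i <= k, g <= 2 * k, 5 * k <= n%:Z + g - h - i &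
      g - n%:Z + h + i <= z <= n%:Z - 2 * g - h - i].

Lemma memY z g h i : (vec4 z g h i \in Y_points) =
  [|| [&& g == -1, h == 0, i == 0 & -2 <= z < 4],
      [&& g == 0, h == 0, i == 0 & -1 <= z < 2],
      [&& z == 0, g == 0, h == 1 & i == 0],
      [&& z == 0, g == 0, h == 0 & i == 1] |
      [&& z == -1, g == 2, h == -1 & i == -1]].
Proof. by rewrite !mem_cat !mem_fiber !inE !vec4_eq. Qed.

Definition Ysum n (u : 'rV[int]_4) :=
  exists z g h i, u = vec4 z g h i /\ inY n z g h i.

(** Once [k] is chosen, [g], [h], [i] and [n] determine how many points come from each other group,
    and [z] fills an interval whose ends turn out not to depend on [k]. *)
Lemma nsumY n z g h i : nsum Y_points n (vec4 z g h i) <-> inY n z g h i.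
Proof.
have YE m z1 g1 h1 i1 : Ysum m (vec4 z1 g1 h1 i1) <-> inY m z1 g1 h1 i1.
  split=> [[z' [g' [h' [i' [/vec4I[-> -> -> ->]]]]]]//|uY].
  by exists z1, g1, h1, i1.
suff : forall m u, nsum Y_points m u <-> Ysum m u by move=> ->.
apply: nsum_char => [u|m u v|m u].
- split=> [[z1 [g1 [h1 [i1 [-> [k [[k1 k2] k3 k4 k5 k6]]]]]]]|->].
    rewrite -vec4_0; congr vec4; lia.
  by rewrite -vec4_0; apply/YE; exists 0.
- have [z1 [g1 [h1 [i1 ->]]]] := vec4P v; rewrite memY => vY.
  move=> [z2 [g2 [h2 [i2 [-> [k [[k1 k2] k3 k4 k5 k6]]]]]]].
  rewrite vec4D; apply/YE; exists (if g1 == 2 then k + 1 else k).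
  by case: eqP => g12; split; try split; lia.
- move=> [z1 [g1 [h1 [i1 [-> [k [[k1 k2] k3 k4 k5 k6]]]]]]].
  suff [z2 [g2 [h2 [i2 [vY]]]]] : exists z2 g2 h2 i2, vec4 z2 g2 h2 i2 \in Y_points /\
      inY m (z1 - z2) (g1 - g2) (h1 - h2) (i1 - i2).
    by exists (vec4 z2 g2 h2 i2); rewrite ?vec4B //; apply/YE.
  have [k0|k0] := ltP 0 k.
    exists (-1), 2, (-1), (-1); rewrite memY; split=> //.
    by exists (k - 1); split; try split; lia.
  have [h0|h0] := ltP 0 h1.
    by exists 0, 0, 1, 0; rewrite memY; split=> //; exists k; split; try split; lia.
  have [i0|i0] := ltP 0 i1.
    by exists 0, 0, 0, 1; rewrite memY; split=> //; exists k; split; try split; lia.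
  have [g0|g0] := ltP g1 0.
    pose j := Num.min 3 (z1 - (g1 + 1 - m%:Z)).
    exists j, (-1), 0, 0; rewrite memY /j; split; first lia.
    by exists k; split; try split; lia.
  have [j j1 jm] : exists2 j : int, -1 <= j < 2 & - m%:Z <= z1 - j <= m%:Z.
    have [zm|zm] := ltP m%:Z z1; first by exists 1; lia.
    by have [zm'|zm'] := ltP z1 (- m%:Z); [exists (-1) | exists 0]; lia.
  exists j, 0, 0, 0; rewrite memY; split; first lia.
  by exists k; split; try split; lia.
Qed.

Lemma polarY N z g h i : polar Y_points N (vec4 z g h i) <->
  [/\ - N%:Z <= z <= N%:Z, 3 * z - g <= N%:Z, - 2 * z - g <= N%:Z,
      h <= N%:Z /\ i <= N%:Z & 2 * g - z - h - i <= N%:Z].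
Proof.
split=> [wN|[z0 z1 z2 [hN iN] w1] u].
  have wY z' g' h' i' : vec4 z' g' h' i' \in Y_points ->
      z * z' + g * g' + h * h' + i * i' <= N%:Z.
    by move=> /wN; rewrite dotz_vec4.
  have := wY (-2) (-1) 0 0; have := wY 3 (-1) 0 0.
  have := wY (-1) 0 0 0; have := wY 1 0 0 0.
  have := wY 0 0 1 0; have := wY 0 0 0 1; have := wY (-1) 2 (-1) (-1).
  rewrite !memY /= => /(_ isT) ? /(_ isT) ? /(_ isT) ? /(_ isT) ? /(_ isT) ? /(_ isT) ? /(_ isT) ?.
  by split; try split; lia.
have [z' [g' [h' [i' ->]]]] := vec4P u; rewrite memY dotz_vec4 => zY.
have : z * z' + g * g' <= N%:Z - h * h' - i * i'; last lia.
case/or4P: zY => [|||/orP[]] /and4P[] /eqP; nia.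
Qed.

(** At height 4 the socle element can only be a sum of points of the middle fibre, hence is not
    divisible by the sequence. At height 5 the value k = 1 becomes available, and z = -1 is low
    enough for every v. *)
Lemma good_Y : good_points Y_points ([:: vec4 (-2) (-1) 0 0; vec4 0 0 1 0;
  vec4 0 0 0 1; vec4 (-1) 2 (-1) (-1)]) 4 (vec4 (-1) 0 0 0).
Proof.
split.
- move=> u; have [z [g [h [i ->]]]] := vec4P u.
  exists (10 * (`|z| + `|g| + `|h| + `|i|))%N; apply/nsumY.
  by exists (`|g|%:Z + `|h|%:Z + `|i|%:Z); split; try split; lia.
- move=> N u; have [z [g [h [i ->]]]] := vec4P u => /polarY[z0 z1 z2 [hN iN] w1].
  suff [z' [g' [h' [i' [/polarY q1 /polarY wq]]]]] : exists z' g' h' i',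
      ([/\ - 1%:Z <= z' <= 1%:Z, 3 * z' - g' <= 1%:Z, - 2 * z' - g' <= 1%:Z,
      h' <= 1%:Z /\ i' <= 1%:Z & 2 * g' - z' - h' - i' <= 1%:Z] /\
      [/\ - N%:Z <= z - z' <= N%:Z, 3 * (z - z') - (g - g') <= N%:Z,
        - 2 * (z - z') - (g - g') <= N%:Z, h - h' <= N%:Z /\ i - i' <= N%:Z &
        2 * (g - g') - (z - z') - (h - h') - (i - i') <= N%:Z]).
    by exists (vec4 z' g' h' i'); rewrite ?vec4B.
  have [z0'|z0'] := ltP 0 z.
    by exists 1, 2, 1, 1; split; split; try split; lia.
  have [z0''|z0''] := ltP z 0.
    by exists (-1), 1, 1, 1; split; split; try split; lia.
  (* With z' = 0 the dual point has 2 g' <= 3, so g' is at most 1 and the rest violates 2 (g - g')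
     <= 3 N. Here z' = 1, with g' = 2, is needed although z = 0. *)
  have [gN|gN] := eqVneq (2 * g) (3 * N%:Z + 3).
    by exists 1, 2, 1, 1; split; split; try split; lia.
  pose g' := Num.min 1 (g + N%:Z).
  pose s := Num.max (2 * g' - 1) (h + i - 2 * N%:Z).
  pose h' := Num.max (h - N%:Z) (s - 1).
  by exists 0, g', h', (s - h'); split; split; try split; rewrite /h' /s /g'; lia.
- move=> u; have [z [g [h [i ->]]]] := vec4P u => uw.
  have uw' a b c e : polar Y_points 1 (vec4 a b c e) -> a * z + b * g + c * h + e * i <= 1.
    by move=> /uw; rewrite dotz_vec4.
  have := uw' 0 (-1) (-4) 1; have := uw' 0 (-1) 1 (-4); have := uw' 0 (-1) 1 1.
  have := uw' (-1) 1 1 1; have := uw' 1 2 1 1.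
  do 5![move=> H; have {H} := H ((polarY 1 _ _ _ _).2 _); move=> H;
    have {H}? := H ltac:(by split; try split)].
  rewrite memY; lia.
- split.
  + move=> u; have [z [g [h [i ->]]]] := vec4P u.
    by rewrite memY !inE !vec4_eq; lia.
  + by rewrite /= !inE !vec4_eq.
  + move=> y y'; have [z [g [h [i ->]]]] := vec4P y.
    have [z' [g' [h' [i' ->]]]] := vec4P y' => yY y'Y yy' m u.
    have [a [b [c [e ->]]]] := vec4P u; rewrite !vec4D.
    move=> /nsumY[k [[k1 k2] k3 k4 k5 k6]] /nsumY[k' [[k1' k2'] k3' k4' k5' k6']].
    apply/nsumY.
    rewrite vec4_eq in yy'.
    move: yY y'Y; rewrite !inE !vec4_eq => yY y'Y.
    (* Each of the four points relaxes a different lower bound on k, so the larger of the two counts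
       meets all of them; both respect the upper bound. *)
    exists (Num.max (if g == 2 then k - 1 else k) (if g' == 2 then k' - 1 else k')).
    by case: eqP => g2; case: eqP => g2'; split; try split; lia.
  + by apply/nsumY; exists 0.
  + move=> [y]; have [z [g [h [i ->]]]] := vec4P y.
    rewrite !inE !vec4_eq vec4B => yY /nsumY[k [[k1 k2] k3 k4 k5 k6]].
    lia.
  + move=> v; have [z [g [h [i ->]]]] := vec4P v; rewrite memY vec4D => vY.
    case/or4P: vY => [|||/orP[]] /and4P[].
    * move=> /eqP-> /eqP-> /eqP-> z1; exists (vec4 (-2) (-1) 0 0).
        exact: mem_head.
      by rewrite vec4B; apply/nsumY; exists 0; split; try split; lia.
    * move=> /eqP-> /eqP-> /eqP-> z1; exists (vec4 (-2) (-1) 0 0).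
        exact: mem_head.
      by rewrite vec4B; apply/nsumY; exists 1; split; try split; lia.
    * move=> /eqP-> /eqP-> /eqP-> /eqP->; exists (vec4 0 0 1 0).
        by rewrite !inE eqxx orbT.
      by rewrite vec4B; apply/nsumY; exists 0.
    * move=> /eqP-> /eqP-> /eqP-> /eqP->; exists (vec4 0 0 0 1).
        by rewrite !inE eqxx !orbT.
      by rewrite vec4B; apply/nsumY; exists 0.
    * move=> /eqP-> /eqP-> /eqP-> /eqP->; exists (vec4 (-1) 2 (-1) (-1)).
        by rewrite !inE eqxx !orbT.
      by rewrite vec4B; apply/nsumY; exists 0.
Qed.

End DepthFour.

(** * Three polytopes of depths 1, 2 and 3 *)

Section SmallDepth.
Context (ea ef : bool) (efa : ef ==> ea).
Implicit Types (z a f b : int) (n N : nat).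

(** A sum of two points over (a, f, b) = (1, 1, 0) is either (1,0,0) + (0,1,0), with z >= 0, or
    (0,0,1) + (1,1,-1), with z <= -2. The gap at z = -1 persists along a + f = n, b = 0, unless a
    lengthened fibre lifts the second kind by one. The holes depend on 2, 1 or 0 parameters, and the
    depth is one more. *)
Definition X_points := fiber 0 (ea + 1) 1 0 0 ++ fiber 0 (ef + 1) 0 1 0 ++
  fiber 0 2 0 0 1 ++ fiber (-4) 2 1 1 (-1) ++
  fiber 1 (3 - ea - ef) (-1) (-1) 0 ++ fiber (-1) 3 0 0 0.

(* The holes are the lattice points of n times the hull that are not sums of n
   points of [X_points]. Lengthening the first two fibers (ea, ef) thins them
   out, which lowers the depth. *)
Definition holeX n z a f b :=
  [&& 1 <= a, 1 <= f, b == 0, z == -1, a + f == n%:Z,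
      ea ==> (a == 1) & ef ==> (f == 1)].

Definition hullX n z a f b :=
  [&& f + b - 3 * a - z <= n%:Z, f - 2 * a - 2 * b <= n%:Z,
      f + b - 2 * a <= n%:Z, a + b - 3 * f - z <= n%:Z,
      a - 2 * f - 2 * b <= n%:Z, a + b - 2 * f <= n%:Z, a + f + b <= n%:Z,
      (if ea then 0 else a) + (if ef then 0 else f) + z <= n%:Z &
      (if ea then - b else a) + (if ef then - b else f) + z - 2 * b <= n%:Z].

Definition inX n z a f b := hullX n z a f b && ~~ holeX n z a f b.

Lemma memX z a f b : (vec4 z a f b \in X_points) =
  [|| [&& a == 1, f == 0, b == 0 & 0 <= z <= ea],
      [&& a == 0, f == 1, b == 0 & 0 <= z <= ef],
      [&& a == 0, f == 0, b == 1 & 0 <= z <= 1],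
      [&& a == 1, f == 1, b == -1 & -4 <= z <= -3],
      [&& a == -1, f == -1, b == 0 & 1 <= z <= 3%:Z - ea%:Z - ef%:Z] |
      [&& a == 0, f == 0, b == 0 & -1 <= z <= 1]].
Proof.
rewrite !mem_cat !mem_fiber; do !congr (_ || _); do 3!congr (_ && _).
all: case: ea efa; case: ef => //= _; lia.
Qed.

Lemma inX_add n z a f b z' a' f' b' : inX n z a f b -> vec4 z' a' f' b' \in X_points ->
  inX n.+1 (z + z') (a + a') (f + f') (b + b').
Proof.
rewrite memX /inX /hullX /holeX; case: ea efa; case: ef => //= _ s v.
all: move: v; do 5?[case/orP]; case/and4P => /eqP-> /eqP-> /eqP-> z'P; lia.
Qed.

Lemma inX_sub n z a f b : inX n.+1 z a f b -> exists z' a' f' b',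
  vec4 z' a' f' b' \in X_points /\ inX n (z - z') (a - a') (f - f') (b - b').
Proof.
have Xt z' : 1 <= z' <= 3%:Z - ea%:Z - ef%:Z -> vec4 z' (-1) (-1) 0 \in X_points.
  by move=> z1; rewrite memX z1 !orbT.
have Xo z' : -1 <= z' <= 1 -> vec4 z' 0 0 0 \in X_points by move=> z1; rewrite memX z1 !orbT.
have Xb z' : 0 <= z' <= 1 -> vec4 z' 0 0 1 \in X_points by move=> z1; rewrite memX z1 !orbT.
have Xc z' : -4 <= z' <= -3 -> vec4 z' 1 1 (-1) \in X_points.
  by move=> z1; rewrite memX z1 !orbT.
have Xa z' : 0 <= z' <= ea%:Z -> vec4 z' 1 0 0 \in X_points by move=> z1; rewrite memX z1.
have Xf z' : 0 <= z' <= ef%:Z -> vec4 z' 0 1 0 \in X_points by move=> z1; rewrite memX z1 orbT.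
have use z' a' f' b' : vec4 z' a' f' b' \in X_points ->
    inX n (z - z') (a - a') (f - f') (b - b') -> exists z' a' f' b',
    vec4 z' a' f' b' \in X_points /\ inX n (z - z') (a - a') (f - f') (b - b').
  by move=> v s; exists z', a', f', b'.
have [ea_ eaE] : exists e, e = ea%:Z by eexists.
have [ef_ efE] : exists e, e = ef%:Z by eexists.
have [e eE] : exists e, e = ea%:Z + ef%:Z :> int by eexists.
(* For given (a, f, b), the points of the hull at height n + 1 have
   bot <= z <= top. *)
have [top topE] : exists t, t = n.+1%:Z - ((if ea then 0 else a) +
    (if ef then 0 else f)) + Num.min 0 ((if ea then b else 0) +
    (if ef then b else 0) + 2 * b) by eexists.
have [bot botE] : exists t,
    t = Num.max (f - 3 * a) (a - 3 * f) + b - n.+1%:Z by eexists.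
rewrite /inX /hullX /holeX in use *; move: use Xt Xa Xf eE topE eaE efE.
case: ea efa; case: ef => //= _ use Xt Xa Xf eE topE eaE efE s.
all: have [t1|t1] := boolP [|| a < 0, f < 0, a + b < 0 | f + b < 0];
  [apply: (use (Num.max 1 (z - top + 3 - e)) (-1) (-1) 0); [apply: Xt|]; lia|].
all: have [n1|n1] := ltP (a + f + b) n.+1%:Z.
1,3,5: have [b0|b0] := eqVneq b 0;
  [have [z0|z0] := leP 0 z; [|have [z1|z1] := eqVneq z (-1)]|];
  [ apply: (use (Num.max 0 (z - top + 1)) 0 0 0)
  | apply: (use (-1) 0 0 0)
  | apply: (use (Num.min 0 (z - bot - 1)) 0 0 0)
  | apply: (use (Num.max (-1) (z - top + 1)) 0 0 0)];
  [apply: Xo| | apply: Xo| | apply: Xo| | apply: Xo| ]; lia.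
(* In the special cases the usual choice would leave z = -1 over b = 0, possibly a hole; the other
   end of the fibre is taken. *)
all: have [b0|b0] := ltP 0 b;
  [have [bz|bz] := boolP ((b == 1) && (z == -1));
   [apply: (use 1 0 0 1) | apply: (use (Num.max 0 (z - top + 1)) 0 0 1)];
   [apply: Xb| | apply: Xb| ]; lia|].
all: have [b1|b1] := ltP b 0;
  [have [bz|bz] := boolP ((b == -1) && (z == -5));
   [apply: (use (-3) 1 1 (-1)) | apply: (use (Num.max (-4) (z - top - 3)) 1 1 (-1))];
   [apply: Xc| | apply: Xc| ]; lia|].
all: have [z0|z0] := leP z (-2);
  [apply: (use (Num.max (-4) (z - top - 1 + e)) 1 1 (-1)); [apply: Xc|];
   lia|].
all: have [z1|z1] := leP 0 z;
  [have [a1|a1] := leP 1 a;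
   [apply: (use (Num.max 0 (z - top + ea_)) 1 0 0) |
    apply: (use (Num.max 0 (z - top + ef_)) 0 1 0)];
   [apply: Xa| | apply: Xf| ]; lia|].
(* Now z = -1, b = 0 and a + f = n.+1. As this is not a hole, a lengthened fibre is available with a
   spare point; its upper end leaves z = -2, below the gap. *)
all: have [a2|a2] := leP 2 a;
  [apply: (use 1 1 0 0); [apply: Xa|] | apply: (use 1 0 1 0); [apply: Xf|]]; lia.
Qed.

Lemma nsumX n z a f b : nsum X_points n (vec4 z a f b) <-> inX n z a f b.
Proof.
pose Xsum m (u : 'rV[int]_4) := exists z a f b, u = vec4 z a f b /\ inX m z a f b.
have XE m z1 a1 f1 b1 : Xsum m (vec4 z1 a1 f1 b1) <-> inX m z1 a1 f1 b1.
  split=> [[z' [a' [f' [b' [/vec4I[-> -> -> ->]]]]]]//|uX].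
  by exists z1, a1, f1, b1.
suff : forall m u, nsum X_points m u <-> Xsum m u by move=> ->.
apply: nsum_char => [u|m u v|m u].
- split=> [[z1 [a1 [f1 [b1 [-> s]]]]]|->].
    rewrite -vec4_0; move: s; rewrite /inX /hullX /holeX.
    by case: ea; case: ef => s; congr vec4; lia.
  by rewrite -vec4_0; apply/XE; rewrite /inX /hullX /holeX; case: ea; case: ef.
- have [z1 [a1 [f1 [b1 ->]]]] := vec4P v => vX [z2 [a2 [f2 [b2 [-> s]]]]].
  by rewrite vec4D; apply/XE/inX_add.
- move=> [z1 [a1 [f1 [b1 [-> /inX_sub[z2 [a2 [f2 [b2 [vX s]]]]]]]]]].
  by exists (vec4 z2 a2 f2 b2); rewrite ?vec4B //; apply/XE.
Qed.

(** On each fibre the pairing is largest at one of the two ends, whence the maxima. *)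
Definition polX N z a f b :=
  [&& - N%:Z <= z <= N%:Z, a + (if ea then Num.max 0 z else 0) <= N%:Z,
      f + (if ef then Num.max 0 z else 0) <= N%:Z, b + Num.max 0 z <= N%:Z,
      a + f - b - 3 * z + Num.max 0 (- z) <= N%:Z &
      z + Num.max 0 ((2%:Z - ea%:Z - ef%:Z) * z) - a - f <= N%:Z].

Lemma polarX N z a f b : polar X_points N (vec4 z a f b) <-> polX N z a f b.
Proof.
split=> [wN|wN u].
  have wX z' a' f' b' : vec4 z' a' f' b' \in X_points ->
      z * z' + a * a' + f * f' + b * b' <= N%:Z.
    by move=> /wN; rewrite dotz_vec4.
  have := wX ea%:Z 1 0 0; have := wX 0 1 0 0.
  have := wX ef%:Z 0 1 0; have := wX 0 0 1 0.
  have := wX 1 0 0 1; have := wX 0 0 0 1.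
  have := wX (-4) 1 1 (-1); have := wX (-3) 1 1 (-1).
  have := wX 1 (-1) (-1) 0; have := wX (3%:Z - ea%:Z - ef%:Z) (-1) (-1) 0.
  have := wX 1 0 0 0; have := wX (-1) 0 0 0.
  rewrite !memX /polX; case: ea efa; case: ef => //= _;
  do 12![move=> /(_ isT) ?]; lia.
have [z' [a' [f' [b' ->]]]] := vec4P u; rewrite memX dotz_vec4.
move: wN; rewrite /polX; case: ea efa; case: ef => //= _ wN.
all: do 5?[case/orP]; case/and4P => /eqP-> /eqP-> /eqP-> z'P.
all: have [z0|z0] := leP 0 z; nia.
Qed.

Lemma decomposable_X : decomposable X_points.
Proof.
move=> N u; have [z [a [f [b ->]]]] := vec4P u => /polarX wN.
suff [z' [a' [f' [b' /andP[q1 wq]]]]] : exists z' a' f' b',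
    polX 1 z' a' f' b' && polX N (z - z') (a - a') (f - f') (b - b').
  by exists (vec4 z' a' f' b'); rewrite ?vec4B; exact/polarX.
have [e eE] : exists e, e = ea%:Z + ef%:Z :> int by eexists.
have [a0 a0E] : exists a, a = 1 - ea%:Z :> int by eexists.
have [f0 f0E] : exists a, a = 1 - ef%:Z :> int by eexists.
move: wN eE a0E f0E; rewrite /polX.
case: ea efa; case: ef => //= _ wN eE a0E f0E.
(* The summand gets the sign of z, so that the maxima in [polX] are additive. *)
all: have [z0|z0] := ltP 0 z;
  [exists 1, a0, f0, (Num.max (b + z - N.+1%:Z) (- 2 - e)); lia|].
all: have [z1|z1] := ltP z 0; [pose a' := Num.max (a - N%:Z) (- 3);
  exists (-1), a', (- 2 - a'), 1; rewrite /a'; lia|].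
all: pose s := Num.max (- 1) (a + f - 2 * N%:Z); pose a' := Num.max (a - N%:Z) (s - 1);
  exists 0, a', (s - a'), (Num.max (b - N%:Z) (s - 1)); rewrite /a' /s; lia.
Qed.

Lemma spanning_X : spanning X_points.
Proof.
move=> u; have [z [a [f [b ->]]]] := vec4P u.
exists (10 * (`|z| + `|a| + `|f| + `|b|))%N; apply/nsumX.
by rewrite /inX /hullX /holeX; case: ea efa; case: ef => //= _; lia.
Qed.

Lemma saturated_X : saturated X_points.
Proof.
move=> u; have [z [a [f [b ->]]]] := vec4P u => uw.
have uw' z' a' f' b' : polX 1 z' a' f' b' ->
    z' * z + a' * a + f' * f + b' * b <= 1.
  by move=> /polarX/uw; rewrite dotz_vec4.
(* These nine dual points are the functionals that define [hullX]. *)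
have := uw' (-1) (-3) 1 1; have := uw' 0 (-2) 1 (-2); have := uw' 0 (-2) 1 1.
have := uw' (-1) 1 (-3) 1; have := uw' 0 1 (-2) (-2); have := uw' 0 1 (-2) 1.
have := uw' 0 1 1 1; have := uw' 1 (1 - ea%:Z) (1 - ef%:Z) 0.
have := uw' 1 (1 - ea%:Z) (1 - ef%:Z) (- 2%:Z - ea%:Z - ef%:Z).
rewrite memX /polX; case: ea efa; case: ef => //= _.
all: do 9![move=> H; have {H}? := H isT].
all: have a1 : a = -1 \/ a = 0 \/ a = 1 by lia.
all: have f1 : f = -1 \/ f = 0 \/ f = 1 by lia.
all: have b1 : b = -1 \/ b = 0 \/ b = 1 by lia.
all: by case: a1 => [|[]] ?; subst a; case: f1 => [|[]] ?; subst f;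
  case: b1 => [|[]] ?; subst b; lia.
Qed.

End SmallDepth.

(** The socle element is the only hole, (-1,1,1,0) at height 2, plus the point of the sequence;
    adding any point to the hole gives an element of the monoid. *)
Lemma good_X11 : good_points (X_points true true) [:: vec4 0 1 0 0] 3 (vec4 (-1) 2 1 0).
Proof.
have nX := @nsumX true true isT.
split; [exact: spanning_X | exact: decomposable_X | exact: saturated_X | split].
- by apply/allP; rewrite /= memX.
- by [].
- by move=> y y'; rewrite !inE => /eqP-> /eqP->; rewrite eqxx.
- exact/nX.
- by move=> [y]; rewrite inE => /eqP->; rewrite vec4B => /nX.
- move=> v; have [z [a [f [b ->]]]] := vec4P v; rewrite memX // => vX.
  exists (vec4 0 1 0 0); first exact: mem_head.
  rewrite vec4D vec4B; apply/nX; move: vX; rewrite /inX /hullX /holeX /=.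
  by do 5?[case/orP]; case/and4P => /eqP-> /eqP-> /eqP->; lia.
Qed.

Lemma good_X10 : good_points (X_points true false) [:: vec4 0 1 0 0; vec4 0 0 1 0]
  3 (vec4 (-1) 2 1 0).
Proof.
have nX := @nsumX true false isT.
split; [exact: spanning_X | exact: decomposable_X | exact: saturated_X | split].
- by apply/allP; rewrite /= !memX.
- by rewrite /= inE vec4_eq.
- move=> y y' /[!inE] /orP[]/eqP-> /orP[]/eqP-> /eqP// _ n u;
    have [z [a [f [b ->]]]] := vec4P u; rewrite !vec4D => /nX s /nX s'; apply/nX;
    by move: s s'; rewrite /inX /hullX /holeX /=; lia.
- exact/nX.
- by move=> [y]; rewrite !inE => /orP[]/eqP->; rewrite vec4B => /nX.
- move=> v; have [z [a [f [b ->]]]] := vec4P v => vX.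
  (* Adding this point to the hole (-1,1,1,0) gives another hole, so it is divided out itself; any
     other point fills the hole. *)
  have [->|vf] := eqVneq (vec4 z a f b) (vec4 0 0 1 0).
    by exists (vec4 0 0 1 0); [rewrite !inE eqxx orbT | rewrite addrK; exact/nX].
  exists (vec4 0 1 0 0); first exact: mem_head.
  rewrite vec4D vec4B; apply/nX; move: vX vf; rewrite memX // vec4_eq.
  rewrite /inX /hullX /holeX /=.
  by do 5?[case/orP]; case/and4P => /eqP-> /eqP-> /eqP->; lia.
Qed.

(** The first two points move holes to holes. The third, added to the hole (-1,1,1,0) of height 2,
    gives the socle element. *)
Lemma good_X00 : good_points (X_points false false)
  [:: vec4 0 1 0 0; vec4 0 0 1 0; vec4 1 (-1) (-1) 0] 3 (vec4 0 0 0 0).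
Proof.
have nX := @nsumX false false isT.
split; [exact: spanning_X | exact: decomposable_X | exact: saturated_X | split].
- by apply/allP; rewrite /= !memX.
- by rewrite /= !inE !vec4_eq.
- move=> y y' /[!inE] /or3P[]/eqP-> /or3P[]/eqP-> /eqP// _ n u;
    have [z [a [f [b ->]]]] := vec4P u; rewrite !vec4D => /nX s /nX s'; apply/nX;
    by move: s s'; rewrite /inX /hullX /holeX /=; lia.
- exact/nX.
- by move=> [y]; rewrite !inE => /or3P[]/eqP->; rewrite vec4B => /nX.
- move=> v; have [z [a [f [b ->]]]] := vec4P v => vX.
  have [->|va] := eqVneq (vec4 z a f b) (vec4 0 1 0 0).
    by exists (vec4 0 1 0 0); [exact: mem_head | rewrite addrK; exact/nX].
  have [->|vf] := eqVneq (vec4 z a f b) (vec4 0 0 1 0).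
    by exists (vec4 0 0 1 0); [rewrite !inE eqxx orbT | rewrite addrK; exact/nX].
  exists (vec4 1 (-1) (-1) 0); first by rewrite !inE eqxx !orbT.
  rewrite vec4D vec4B; apply/nX; move: vX va vf; rewrite memX // !vec4_eq.
  rewrite /inX /hullX /holeX /=.
  by do 5?[case/orP]; case/and4P => /eqP-> /eqP-> /eqP->; lia.
Qed.

(** * All pairs of dimension and depth *)

Definition good_depth d r :=
  exists (V ys : seq 'rV[int]_d) n u, good_points V ys n u /\ size ys = r.

Lemma good_depth0 : good_depth 0 1.
Proof.
exists [:: 0], [:: 0], 0%N, 0; split=> //.
have V0 (v : 'rV[int]_0) : v \in [:: 0] by rewrite [v]thinmx0 mem_head.
split.
- by move=> v; exists 0%N; rewrite [v]thinmx0.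
- by move=> N w _; exists 0; move=> v _; rewrite [v]thinmx0 dotz0r.
- by [].
- split=> //.
  + by move=> y y' _ _ /eqP[]; rewrite [y]thinmx0 [y']thinmx0.
  + move=> v _; exists 0; first exact: mem_head.
    by rewrite [X in nsum _ _ X]thinmx0.
Qed.

Lemma good_depth_bipyramid d r j : (0 < r)%N -> good_depth d r ->
  good_depth (j + d) (j + r).
Proof.
move=> r_gt0 dr; elim: j => [//|j [V [ys [n [u [VP sz]]]]]].
case: ys VP sz => [|y ys] VP sz; first by move: sz; rewrite /=; lia.
have yV : y \in V by apply: cert_sub (good_certificate VP) _ _; exact: mem_head.
do 4!eexists; split; first exact: (good_bipyramid yV VP).
by move: sz; rewrite /= size_map => ->; rewrite addSn.
Qed.

Lemma good_depth_prism j : good_depth (j + 4) 1.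
Proof.
suff [V [y [n [u [n_gt0 VP]]]]] : exists (V : seq 'rV[int]_(j + 4)) y n u,
    (0 < n)%N /\ good_points V [:: y] n u by exists V, [:: y], n, u.
elim: j => [|j [V [y [n [u [n_gt0 VP]]]]]].
  by do 4!eexists; split; last exact: good_X11.
by do 4!eexists; split; last exact: (good_prism n_gt0 VP).
Qed.

Lemma good_depth_exists d r : (4 <= d)%N -> (1 <= r <= d.+1)%N -> good_depth d r.
Proof.
move=> d4 /andP[r1 rd].
have good4 s : (0 < s)%N -> good_depth 4 s -> r = (d - 4 + s)%N -> good_depth d r.
  by move=> s1 /(good_depth_bipyramid (d - 4) s1) + ->; rewrite subnK.
have [rE|r_neq] := eqVneq r d.+1.
  by have := good_depth_bipyramid d (ltnSn 0) good_depth0; rewrite addn0 addn1 -rE.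
have [rE|r_neq1] := eqVneq r d.
  by apply: (good4 4%N) => //; [do 4!eexists; split; first exact: good_Y | lia].
have [rE|r_neq2] := eqVneq r.+1 d.
  by apply: (good4 3%N) => //; [do 4!eexists; split; first exact: good_X00 | lia].
have [rE|r_neq3] := eqVneq r.+2 d.
  by apply: (good4 2%N) => //; [do 4!eexists; split; first exact: good_X10 | lia].
(* Depth 1 in dimension d + 1 - r, followed by r - 1 bipyramids. *)
have := good_depth_bipyramid r.-1 (ltnSn 0) (good_depth_prism (d - 3 - r)).
by congr good_depth; lia.
Qed.

Theorem theorem0p1 (K : fieldType) (R : realType) (d r : nat)
    (hd : (4 <= d)%N) (hr : (1 <= r <= d.+1)%N) :
  exists P : set 'rV[R]_d,
    [/\ reflexive_polytope P,
        depth_toric_ring K P r &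
        normal_polytope (dual P)].
Proof.
have [V [ys [n [u [[spV decV satV cert] <-]]]]] := good_depth_exists hd hr.
have d_gt0 : (0 < d)%N by lia.
have [refl norm PV] := reflexive_normal_hull R d_gt0 spV decV satV.
by eexists; split; [exact: refl | exact: (depth_toric_ring_cert K PV cert) | exact: norm].
Qed.
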